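(* Let $\Lambda$ be an artin algebra and let $\mathcal{S}$ be a subset of the set $\mathcal{S}^{<\infty}$ of all pairwise non-isomorphic simple $\Lambda$-modules with finite projective dimension. Then $$\dim(\mathrm{mod}\,\Lambda)\leq \mathrm{pd}\,\mathcal{S}+\ell\ell^{t_{\mathcal{S}}}(\Lambda).$$
   Context: $\mathrm{mod}\,\Lambda$ is the category of finitely generated right $\Lambda$-modules; simple modules are taken in $\mathrm{mod}\,\Lambda$ up to isomorphism, and $\Lambda$ is viewed as a right module over itself. Projective dimension of a class: $\mathrm{pd}\,\mathcal{S}:=\sup\{\mathrm{pd}\,M\mid M\in\mathcal{S}\}$ if $\mathcal{S}\neq\emptyset$, and $\mathrm{pd}\,\mathcal{S}:=-1$ if $\mathcal{S}=\emptyset$. The $t_{\mathcal{S}}$-radical layer length: let $\mathcal{S}'$ be the set of all simple modules in $\mathrm{mod}\,\Lambda$ not in $\mathcal{S}$, and let $\mathcal{T}_{\mathcal{S}}:=\{M\in\mathrm{mod}\,\Lambda\mid \mathrm{top}\,M\in\mathrm{add}\,\mathcal{S}'\}$, where $\mathrm{top}\,M=M/\mathrm{rad}\,M$. Let $\mathfrak{F}(\mathcal{S})$ be the class of modules $M\in\mathrm{mod}\,\Lambda$ having a finite chain of submodules $0=M_0\subseteq M_1\subseteq\cdots\subseteq M_m=M$ with each $M_i/M_{i-1}$ isomorphic to a module in $\mathcal{S}$. Then $(\mathcal{T}_{\mathcal{S}},\mathfrak{F}(\mathcal{S}))$ is a torsion pair in $\mathrm{mod}\,\Lambda$; its torsion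 radical $t_{\mathcal{S}}$ is given by $t_{\mathcal{S}}(M):=\sum\{\mathrm{Im}\,f\mid f\in\mathrm{Hom}_\Lambda(T,M),\ T\in\mathcal{T}_{\mathcal{S}}\}$, the largest submodule of $M$ lying in $\mathcal{T}_{\mathcal{S}}$. Put $F_{t_{\mathcal{S}}}:=\mathrm{rad}\circ t_{\mathcal{S}}$, where $\mathrm{rad}$ is the Jacobson radical functor on modules. For $M\in\mathrm{mod}\,\Lambda$, $\ell\ell^{t_{\mathcal{S}}}(M):=\inf\{i\ge 0\mid t_{\mathcal{S}}\big(F_{t_{\mathcal{S}}}^{i}(M)\big)=0\}$. Extension dimension: let $\mathcal{A}$ be an abelian category. For a class $\mathcal{U}$ of objects, $\mathrm{add}\,\mathcal{U}$ is the full subcategory of direct summands of finite direct sums of objects of $\mathcal{U}$. For subcategories $\mathcal{U}_1,\mathcal{U}_2$, $\mathcal{U}_1\diamond\mathcal{U}_2:=\mathrm{add}\{A\in\mathcal{A}\mid \text{there is an exact sequence } 0\to U_1\to A\to U_2\to 0 \text{ with } U_1\in\mathcal{U}_1, U_2\in\mathcal{U}_2\}$. For $T\in\mathcal{A}$: $\langle T\rangle_0=0$, $\langle T\rangle_1=\mathrm{add}\,T$, $\langle T\rangle_n=\langle T\rangle_1\diamond\langle T\rangle_{n-1}$ for $n\ge 2$. Then $\dim\mathcal{A}:=\inf\{n\ge 0\mid \mathcal{A}=\langle T\rangle_{n+1}\text{ for some }T\in\mathcal{A}\}$ (with $\inf\emptyset=+\infty$). *)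

(* Defs.v *)
From HB Require Import structures.
From mathcomp Require Import all_boot all_order all_algebra.
From mathcomp Require Import generic_quotient ring_quotient.
From mathcomp Require Import boolp classical_sets constructive_ereal.

Set Implicit Arguments.
Unset Strict Implicit.
Unset Printing Implicit Defensive.

Import Order.TTheory GRing.Theory Num.Theory.
Local Open Scope ring_scope.
Local Open Scope quotient_scope.

(* Modules over R are mathcomp's (left) lmodType R; right modules over A are
   therefore the left modules over the opposite ring A^c.  Submodules of M are
   the boolean predicates of type submodClosed M; classically these are all
   the submodules. *)

Section Modules.
Variable R : pzRingType.
Implicit Types M N P T : lmodType R.

Definition fgen M : Prop :=
  exists n (e : 'I_n -> M),
    forall x : M, exists c : 'I_n -> R, x = \sum_i c i *: e i.

Definition zero_module M : Prop := forall x : M, x = 0.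

Definition isomorphic M N : Prop := exists f : {linear M -> N}, bijective f.

Definition surjective M N (f : {linear M -> N}) : Prop :=
  forall y, exists x, f x = y.

Definition short_exact M N P (f : {linear M -> N}) (g : {linear N -> P}) :=
  [/\ injective f, surjective g
    & forall y, g y = 0 <-> exists x, f x = y].

Definition artinian_module M : Prop :=
  forall I : nat -> submodClosed M,
    (forall n, {subset I n.+1 <= I n}) ->
    exists n, forall m, (n <= m)%N -> I m =i I n.

Definition simple_module M : Prop :=
  (exists x : M, x != 0) /\
  forall N : submodClosed M,
    (forall x, x \in N -> x = 0) \/ (forall x, x \in N).

Definition maximal_submodule M (N : submodClosed M) : Prop :=
  (exists x, x \notin N) /\
  forall N' : submodClosed M,
    {subset N <= N'} -> N' =i N \/ (forall x, x \in N').

Definition sub_module M (N : submodClosed M) : Type := {x : M | x \in N}.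

Section SubModule.
Variables (M : lmodType R) (N : submodClosed M).
HB.instance Definition _ := SubChoice.on (sub_module N).
HB.instance Definition _ := [SubChoice_isSubLmodule of sub_module N by <:].
End SubModule.

(* mathcomp does not derive zmodClosed, which quotients require, from
   submodClosed, whose scalars may form a mere semiring. *)
Definition submod_pred M (N : submodClosed M) : {pred M} := fun x => x \in N.

Fact submod_pred_zmod M (N : submodClosed M) : zmod_closed (submod_pred N).
Proof.
split=> [|x y xN yN]; first exact: (rpred0 N).
by rewrite -scaleN1r; apply: (rpredD xN); apply: rpredZ.
Qed.

HB.instance Definition _ M (N : submodClosed M) :=
  GRing.isZmodClosed.Build M (submod_pred N) (submod_pred_zmod N).

Definition quo_module M (N : submodClosed M) : Type :=
  Quotient.quot (submod_pred N).

Section QuoModule.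
Variables (M : lmodType R) (N : submodClosed M).
Local Notation Q := (quo_module N).
HB.instance Definition _ := GRing.Zmodule.on Q.

Definition quo_pi (x : M) : Q := \pi_(Quotient.quot (submod_pred N)) x.

Lemma quo_piP x y : quo_pi x = quo_pi y <-> x - y \in N.
Proof.
by split; rewrite (@Quotient.idealrBE M (submod_pred N)) => H; apply/eqP.
Qed.

Lemma quo_pi_surj (q : Q) : exists x, quo_pi x = q.
Proof. by exists (repr (q : Quotient.quot (submod_pred N))); exact: reprK. Qed.

Lemma quo_piD : {morph quo_pi : x y / x + y}.
Proof. by move=> x y; rewrite /quo_pi piE. Qed.

Definition quo_scale (a : R) (q : Q) : Q :=
  quo_pi (a *: repr (q : Quotient.quot (submod_pred N))).

Lemma quo_scale_pi a x : quo_scale a (quo_pi x) = quo_pi (a *: x).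
Proof.
by apply/quo_piP; rewrite -scalerBr rpredZ //; apply/quo_piP; exact: reprK.
Qed.

Fact quo_scaleA a b q : quo_scale a (quo_scale b q) = quo_scale (a * b) q.
Proof. by have [x <-] := quo_pi_surj q; rewrite !quo_scale_pi scalerA. Qed.

Fact quo_scale1 : left_id 1 quo_scale.
Proof.
by move=> q; have [x <-] := quo_pi_surj q; rewrite quo_scale_pi scale1r.
Qed.

Fact quo_scaleDr : right_distributive quo_scale +%R.
Proof.
move=> a p q; have [x <-] := quo_pi_surj p; have [y <-] := quo_pi_surj q.
by rewrite -quo_piD !quo_scale_pi scalerDr quo_piD.
Qed.

Fact quo_scaleDl q : {morph quo_scale^~ q : a b / a + b}.
Proof.
move=> a b; have [x <-] := quo_pi_surj q.
by rewrite !quo_scale_pi scalerDl quo_piD.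
Qed.

HB.instance Definition _ := GRing.Zmodule_isLmodule.Build R Q
  quo_scaleA quo_scale1 quo_scaleDr quo_scaleDl.

End QuoModule.

Definition rad M : {pred M} := fun x =>
  `[< forall N : submodClosed M, maximal_submodule N -> x \in N >].
Arguments rad M : clear implicits.

Fact rad_submod_closed M : submod_closed (rad M).
Proof.
split=> [|a x y /asboolP xR /asboolP yR]; apply/asboolP => N maxN.
  exact: rpred0.
by rewrite rpredD ?rpredZ ?xR ?yR.
Qed.

HB.instance Definition _ M :=
  GRing.isSubmodClosed.Build R M (rad M) (@rad_submod_closed M).

Definition top M : lmodType R := quo_module (rad M).

Definition direct_sum n (X : 'I_n -> lmodType R) : lmodType R :=
  \big[(fun M N => (M * N)%type : lmodType R) / ('rV[R]_0 : lmodType R)]_(i < n)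
     X i.

(* Full subcategories of mod R are given by predicates on modules. *)
Definition in_add (U : lmodType R -> Prop) M : Prop :=
  fgen M /\
  exists n (X : 'I_n -> lmodType R) M',
    (forall i, U (X i)) /\ isomorphic (M * M')%type (direct_sum X).

Definition diamond (U1 U2 : lmodType R -> Prop) : lmodType R -> Prop :=
  in_add (fun A => fgen A /\
    exists (M1 M2 : lmodType R) (f : {linear M1 -> A}) (g : {linear A -> M2}),
      [/\ U1 M1, U2 M2 & short_exact f g]).

Fixpoint tower T (n : nat) : lmodType R -> Prop :=
  match n with
  | 0 => zero_module
  | 1 => in_add (fun M => M = T)
  | m.+1 => diamond (in_add (fun M => M = T)) (tower T m)
  end.

Definition nat_inf (A : set nat) : \bar int :=
  infimum +oo%E [set (n%:Z)%:E | n in A]%classic.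

(* The dimension of the abelian category of finitely generated R-modules. *)
Definition ext_dim : \bar int :=
  nat_inf (fun n => exists T, fgen T /\
    forall M, fgen M <-> tower T n.+1 M).

Definition projective P : Prop :=
  forall (B C : lmodType R) (g : {linear B -> C}) (f : {linear P -> C}),
    surjective g -> exists h : {linear P -> B}, forall x, g (h x) = f x.

(* 0 -> P n -> ... -> P 1 -> P 0 -> M -> 0 *)
Definition has_proj_resolution M (n : nat) : Prop :=
  exists (P : nat -> lmodType R) (d : forall i, {linear P i.+1 -> P i})
         (e : {linear P 0 -> M}),
    [/\ forall i, fgen (P i) /\ projective (P i),
        surjective e,
        forall x, e x = 0 <-> exists y, d 0 y = x,
        forall i x, d i x = 0 <-> exists y, d i.+1 y = x
      & forall i, (n < i)%N -> zero_module (P i)].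

Definition pd M : \bar int := nat_inf (has_proj_resolution M).

Definition pd_class (S : lmodType R -> Prop) : \bar int :=
  supremum (-1)%:E
    (fun v : \bar int => exists M, S M /\ pd M = v).

Section LayerLength.
(* S need not be closed under isomorphism: membership of a simple module is
   always tested up to isomorphism. *)
Variable S : lmodType R -> Prop.

Definition simple_notin M : Prop :=
  simple_module M /\ ~ (exists N, S N /\ isomorphic M N).

Definition torsion_class M : Prop := fgen M /\ in_add simple_notin (top M).

(* The sum of the images of all linear maps T -> M with T in the class. *)
Definition torsion M : {pred M} := fun x =>
  `[< exists n (x_ : 'I_n -> M), x = \sum_i x_ i /\
      forall i, exists T (f : {linear T -> M}),
        torsion_class T /\ exists t, f t = x_ i >].
Arguments torsion M : clear implicits.

Fact torsion_submod_closed M : submod_closed (torsion M).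
Proof.
split=> [|a x y].
  apply/asboolP; exists 0, (fun=> 0); split; first by rewrite big_ord0.
  by case.
move=> /asboolP[m [x_ [-> xT]]] /asboolP[n [y_ [-> yT]]]; apply/asboolP.
exists (m + n)%N, (fun i => match split i with
                            | inl j => a *: x_ j | inr j => y_ j end).
split.
  rewrite big_split_ord /= scaler_sumr; congr (_ + _); apply: eq_bigr => i _.
    by rewrite (unsplitK (inl _ i)).
  by rewrite (unsplitK (inr _ i)).
move=> i; case: (split i) => j; last exact: yT.
have [T [f [TT [t ft]]]] := xT j.
by exists T, f; split=> //; exists (a *: t); rewrite linearZ ft.
Qed.

HB.instance Definition _ M :=
  GRing.isSubmodClosed.Build R M (torsion M) (@torsion_submod_closed M).

Definition rad_torsion M : lmodType R :=
  sub_module (rad (sub_module (torsion M))).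

Definition layer_length M : \bar int :=
  nat_inf (fun i =>
    zero_module (sub_module (torsion (iter i rad_torsion M)))).

End LayerLength.

End Modules.

Arguments fgen {R} M.
Arguments ext_dim R : clear implicits.

Definition artin_algebra (k : comNzRingType) (A : algType k) : Prop :=
  artinian_module k^o /\ fgen A.

(* Main.v *)
From HB Require Import structures.
From mathcomp Require Import all_boot all_order all_algebra.
From mathcomp Require Import boolp classical_sets constructive_ereal.
Require Import Defs.

Set Implicit Arguments.
Unset Strict Implicit.
Unset Printing Implicit Defensive.

Import Order.TTheory GRing.Theory Num.Theory.
Local Open Scope ring_scope.

(** Write R for the opposite algebra, p for pd S + 1 and n for the layer length
    of R; the case where one of the two is infinite is trivial.  One T has to
    be found such that every finitely generated M is obtained in p + n steps
    from add T, where a step is an extension of what was built so far by a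
    submodule in add T, followed by passing to a direct summand.

    Taking p-th syzygies brings the number of steps down to n.  In the
    filtration of M by the submodules F^i(M), F = rad t, each quotient
    F^i(M) / t(F^i(M)) is filtered by simples from S, so that its p-th syzygy
    vanishes, and each t(F^i(M)) / F^(i+1)(M) is the top of t(F^i(M)), hence a
    direct sum of simples.  By the horseshoe lemma the p-th syzygy of M is
    built in n steps from the p-th syzygies of the finitely many simples
    ([nth_syzygy_built]).  The number n suffices for every M because the torsion
    radical and the radical both preserve monomorphisms and epimorphisms, so
    that the layer length of a quotient of a free module is at most that of R
    ([layers_le_all]).

    To return from a syzygy L of M to M, where 0 -> L -> P -> M -> 0, embed L
    in an injective I, with cokernel C.  The pushout of P and I over L is
    M * I, and 0 -> P -> M * I -> C -> 0 is exact ([ses_rotate]): M is one step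
    away from a cosyzygy of L, and cosyzygies preserve the number of steps
    ([built_cosyzygy]).  Doing this p times costs p steps ([built_from_syzygy]).

    The argument uses finitely generated injectives.  They exist over an artin
    algebra because the finitely generated modules with a simple essential
    socle have bounded length ([artin_algebra_bounds]): an essential extension
    of a simple module that has maximal length among those is injective
    ([simple_envelope]). *)

(** * Linear maps, submodules and quotients *)

Section LinearMaps.
Variable R : pzRingType.
Implicit Types M N P Q X Y Z : lmodType R.

Lemma linear_of M N (f : M -> N) :
  (forall a x y, f (a *: x + y) = a *: f x + f y) ->
  exists F : {linear M -> N}, forall x, F x = f x.
Proof.
move=> H; pose X := GRing.isLinear.Build R M N _ f H.
pose F : {linear M -> N} := HB.pack f X.
by exists F.
Qed.

Definition is_submod M (P : M -> Prop) :=
  P 0 /\ forall a x y, P x -> P y -> P (a *: x + y).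

Lemma submod_of M (P : M -> Prop) :
  is_submod P -> exists N : submodClosed M, forall x, x \in N <-> P x.
Proof.
case=> P0 PD.
have H : submod_closed (fun x : M => `[<P x>] : bool).
  split=> [|a x y]; first by apply/asboolP.
  by move=> /asboolP Px /asboolP Py; apply/asboolP; apply: PD.
pose X := GRing.isSubmodClosed.Build R M (fun x : M => `[<P x>]) H.
pose N : submodClosed M := HB.pack (fun x : M => `[<P x>]) X.
by exists N => x; split => [/asboolP|Px] //; apply/asboolP.
Qed.

Lemma mem_is_submod M (N : submodClosed M) : is_submod (fun x => x \in N).
Proof. by split=> [|a x y xN yN]; [exact: rpred0 | rewrite rpredD ?rpredZ]. Qed.

Lemma sub_module_of M (P : M -> Prop) : is_submod P ->
  exists (N : lmodType R) (i : {linear N -> M}),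
    injective i /\ forall x, P x <-> exists y, i y = x.
Proof.
move=> /submod_of[N NP].
exists (sub_module N), (val : {linear sub_module N -> M}); split.
  exact: val_inj.
move=> x; rewrite -NP; split=> [xN|[y <-]]; last exact: (valP y).
by exists (exist _ x xN).
Qed.

Lemma quo_lin M (N : submodClosed M) :
  exists g : {linear M -> quo_module N}, surjective g /\ forall x,
    g x = 0 <-> x \in N.
Proof.
have [g gE] : exists g : {linear M -> quo_module N}, forall x, g x = quo_pi N x.
  apply: linear_of => a x y; rewrite quo_piD; congr (_ + _).
  by rewrite -[RHS]/(quo_scale a _) quo_scale_pi.
exists g; split=> [q|x]; first by have [x <-] := quo_pi_surj q; exists x.
by rewrite -(linear0 g) !gE quo_piP subr0.
Qed.

Lemma quotient_of M (P : M -> Prop) : is_submod P ->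
  exists (Q : lmodType R) (g : {linear M -> Q}),
    surjective g /\ forall x, g x = 0 <-> P x.
Proof.
move=> /submod_of[N NP]; have [g [gS gP]] := quo_lin N.
by exists (quo_module N), g; split=> // x; rewrite gP NP.
Qed.

Lemma injP M N (f : {linear M -> N}) :
  injective f <-> forall x, f x = 0 -> x = 0.
Proof.
split=> [fI x fx|H x y /eqP]; first by apply: fI; rewrite fx linear0.
by rewrite -subr_eq0 -linearB => /eqP/H/eqP; rewrite subr_eq0 => /eqP.
Qed.

Lemma factor_lin X Y Z (g : {linear X -> Y}) (h : {linear X -> Z}) :
  surjective g -> (forall x, g x = 0 -> h x = 0) ->
  exists u : {linear Y -> Z}, forall x, u (g x) = h x.
Proof.
move=> gS gh; have [s sP] := choice gS.
have hs x : h (s (g x)) = h x.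
  by apply/eqP; rewrite -subr_eq0 -linearB gh // linearB sP subrr.
have [u uE] : exists u : {linear Y -> Z}, forall y, u y = h (s y).
  apply: linear_of => a x y.
  by rewrite -{1}(sP x) -{1}(sP y) -linearP hs linearP.
by exists u => x; rewrite uE hs.
Qed.

Lemma lift_lin X Y Z (f : {linear Y -> Z}) (h : {linear X -> Z}) :
  injective f -> (forall x, exists y, f y = h x) ->
  exists u : {linear X -> Y}, forall x, f (u x) = h x.
Proof.
move=> fI /choice[s sP].
have [u uE] : exists u : {linear X -> Y}, forall y, u y = s y.
  by apply: linear_of => a x y; apply: fI; rewrite linearP !sP linearP.
by exists u => x; rewrite uE.
Qed.

Lemma pair_lin X Y Z (f : {linear X -> Y}) (g : {linear X -> Z}) :
  exists h : {linear X -> (Y * Z)%type}, forall x, h x = (f x, g x).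
Proof. by apply: linear_of => a x y; rewrite !linearP. Qed.

Lemma copair_lin X Y Z (f : {linear X -> Z}) (g : {linear Y -> Z}) :
  exists h : {linear (X * Y)%type -> Z}, forall p, h p = f p.1 + g p.2.
Proof.
by apply: linear_of => a x y; rewrite !linearP scalerDr addrACA.
Qed.

Lemma prod_lin X X' Y Y' (f : {linear X -> Y}) (g : {linear X' -> Y'}) :
  exists h : {linear (X * X')%type -> (Y * Y')%type},
    forall p, h p = (f p.1, g p.2).
Proof. by apply: linear_of => a x y; rewrite !linearP. Qed.

Lemma ker_is_submod M N (f : {linear M -> N}) : is_submod (fun x => f x = 0).
Proof. by split=> [|a x y fx fy]; rewrite ?linear0 // linearP fx fy scaler0
  addr0. Qed.

Lemma im_is_submod M N (f : {linear M -> N}) :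
  is_submod (fun y => exists x, f x = y).
Proof.
split=> [|a x y [x' <-] [y' <-]]; first by exists 0; rewrite linear0.
by exists (a *: x' + y'); rewrite linearP.
Qed.

Lemma preim_is_submod M N (f : {linear M -> N}) (P : N -> Prop) :
  is_submod P -> is_submod (fun x => P (f x)).
Proof.
by case=> P0 PD; split=> [|a x y Px Py]; rewrite ?linear0 // linearP; apply: PD.
Qed.

Lemma img_is_submod M N (f : {linear M -> N}) (P : M -> Prop) :
  is_submod P -> is_submod (fun y => exists2 x, P x & f x = y).
Proof.
case=> P0 PD; split=> [|a x y [x' Px <-] [y' Py <-]].
  by exists 0; rewrite ?linear0.
by exists (a *: x' + y'); [apply: PD | rewrite linearP].
Qed.

Lemma line_is_submod M (x : M) : is_submod (fun y => exists a : R, y = a *: x).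
Proof.
split=> [|a y z [b ->] [c ->]]; first by exists 0; rewrite scale0r.
by exists (a * b + c); rewrite scalerDl scalerA.
Qed.

Lemma cap_is_submod M (P Q : M -> Prop) :
  is_submod P -> is_submod Q -> is_submod (fun x => P x /\ Q x).
Proof.
by move=> [P0 PD] [Q0 QD]; split=> // a x y [Px Qx] [Py Qy]; split; auto.
Qed.

Lemma add_is_submod M (P Q : M -> Prop) : is_submod P -> is_submod Q ->
  is_submod (fun x => exists y z, [/\ P y, Q z & x = y + z]).
Proof.
move=> [P0 PD] [Q0 QD]; split.
  by exists 0, 0; rewrite addr0.
move=> a x y [x1 [x2 [Px Qx ->]]] [y1 [y2 [Py Qy ->]]].
exists (a *: x1 + y1), (a *: x2 + y2); split; auto.
by rewrite scalerDr addrACA.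
Qed.

Lemma is_submodB M (P : M -> Prop) x y : is_submod P -> P x -> P y -> P (x - y).
Proof. by move=> [_ PD] Px Py; rewrite addrC -scaleN1r; apply: PD. Qed.
Lemma is_submodD M (P : M -> Prop) x y : is_submod P -> P x -> P y -> P (x + y).
Proof. by move=> [_ PD] Px Py; rewrite -[x]scale1r; apply: PD. Qed.
Lemma is_submodZ M (P : M -> Prop) a x : is_submod P -> P x -> P (a *: x).
Proof. by move=> [P0 PD] Px; rewrite -[_ *: _]addr0; apply: PD. Qed.

(** * Short exact sequences, retracts and powers *)

Definition ses X Y Z := exists f g, @short_exact R X Y Z f g.

Lemma ses_ker Y Z (g : {linear Y -> Z}) : surjective g ->
  exists X (f : {linear X -> Y}), short_exact f g.
Proof.
move=> gS; have [X [f [fI fP]]] := sub_module_of (ker_is_submod g).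
by exists X, f; split.
Qed.

Lemma ses_coker X Y (f : {linear X -> Y}) : injective f ->
  exists Z (g : {linear Y -> Z}), short_exact f g.
Proof.
move=> fI; have [Z [g [gS gP]]] := quotient_of (im_is_submod f).
by exists Z, g; split.
Qed.

Lemma zero_module_ex : exists Z : lmodType R, zero_module Z.
Proof. by exists ('rV[R]_0 : lmodType R) => x; apply/rowP => -[]. Qed.

Lemma iso_lin X Y (f : {linear X -> Y}) : injective f -> surjective f ->
  exists g : {linear Y -> X}, cancel f g /\ cancel g f.
Proof.
move=> fI fS; have [|g gP] := @lift_lin Y X Y f idfun fI.
  by move=> y; have [x <-] := fS y; exists x.
by exists g; split=> // x; apply: fI; rewrite gP.
Qed.

Lemma inj_surj_iso X Y (f : {linear X -> Y}) :
  injective f -> surjective f -> isomorphic X Y.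
Proof. by move=> fI fS; have [g [fK gK]] := iso_lin fI fS; exists f, g. Qed.

Lemma isoE X Y : isomorphic X Y ->
  exists (f : {linear X -> Y}) (g : {linear Y -> X}), cancel f g /\ cancel g f.
Proof.
case=> f [g fK gK]; have [|h hP] := iso_lin (can_inj fK); last by exists f, h.
by move=> y; exists (g y).
Qed.

Lemma ses_iso X Y Z : isomorphic X Y -> zero_module Z -> ses X Y Z.
Proof.
move=> /isoE[f [g [fK gK]]] Z0; exists f, (\0 : {linear Y -> Z}).
split; [exact: can_inj fK| by move=> y; exists 0; rewrite [y]Z0|].
by move=> y; split=> // _; exists (g y).
Qed.

Lemma ses_zero_r X Y Z : zero_module Z -> ses X Y Z -> isomorphic X Y.
Proof.
move=> Z0 [f [g [fI gS fg]]]; apply: (inj_surj_iso fI) => y.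
by apply/fg; rewrite [g y]Z0.
Qed.

Lemma ses_zero_l X Y Z : zero_module X -> ses X Y Z -> isomorphic Y Z.
Proof.
move=> X0 [f [g [fI gS fg]]]; apply: (inj_surj_iso _ gS).
by apply/injP => y /fg[x <-]; rewrite (X0 x) linear0.
Qed.

Lemma iso_zero_l X Y : zero_module X -> zero_module Y -> isomorphic X Y.
Proof.
move=> X0 Y0; exists (\0 : {linear X -> Y}); exists (fun=> 0) => z.
  by rewrite [z]X0.
by rewrite [z]Y0 /=.
Qed.

Lemma iso_refl X : isomorphic X X.
Proof. by exists (idfun : {linear X -> X}); exists id. Qed.

Lemma iso_sym X Y : isomorphic X Y -> isomorphic Y X.
Proof. by move=> /isoE[f [g [fK gK]]]; exists g, f. Qed.

Lemma iso_trans X Y Z : isomorphic X Y -> isomorphic Y Z -> isomorphic X Z.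
Proof.
move=> /isoE[f [f' [fK f'K]]] /isoE[g [g' [gK g'K]]].
by exists (g \o f : {linear _ -> _}), (f' \o g') => x /=; rewrite ?gK ?f'K.
Qed.

Lemma ses_prod X Y Z X' Y' Z' : ses X Y Z -> ses X' Y' Z' ->
  ses (X * X')%type (Y * Y')%type (Z * Z')%type.
Proof.
move=> [f [g [fI gS fg]]] [f' [g' [fI' gS' fg']]].
have [F FE] := prod_lin f f'; have [G GE] := prod_lin g g'.
exists F, G; split.
- by move=> [a b] [c d]; rewrite !FE => -[/fI-> /fI'->].
- move=> [z z']; have [y <-] := gS z; have [y' <-] := gS' z'.
  by exists (y, y'); rewrite GE.
move=> [y y']; rewrite GE; split=> [[/fg[x <-] /fg'[x' <-]]|[[x x']]].
  by exists (x, x'); rewrite FE.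
by rewrite FE => -[<- <-] /=; congr (_, _); [apply/fg|apply/fg'];
  [exists x|exists x'].
Qed.

Definition retract X Y :=
  exists (i : {linear X -> Y}) (r : {linear Y -> X}), cancel i r.

Lemma retract_refl X : retract X X.
Proof. by exists (idfun : {linear X -> X}), (idfun : {linear X -> X}). Qed.

Lemma retract_trans X Y Z : retract X Y -> retract Y Z -> retract X Z.
Proof.
move=> [i [r ir]] [j [s js]].
by exists (j \o i : {linear _ -> _}), (r \o s : {linear _ -> _}) => x /=;
  rewrite js ir.
Qed.

Lemma retract_iso X Y : isomorphic X Y -> retract X Y.
Proof. by move=> /isoE[f [g [fK _]]]; exists f, g. Qed.

Lemma retract_prod X Y X' Y' : retract X Y -> retract X' Y' ->
  retract (X * X')%type (Y * Y')%type.
Proof.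
move=> [i [r ir]] [j [s js]].
have [F FE] := prod_lin i j; have [G GE] := prod_lin r s.
by exists F, G => -[x x']; rewrite GE FE ir js.
Qed.

Lemma retract_fst X Y : retract X (X * Y)%type.
Proof.
have [h hE] := pair_lin (idfun : {linear X -> X}) (\0 : {linear X -> Y}).
by exists h, fst => x; rewrite hE.
Qed.

Lemma retract_snd X Y : retract Y (X * Y)%type.
Proof.
have [h hE] := pair_lin (\0 : {linear Y -> X}) (idfun : {linear Y -> Y}).
by exists h, snd => x; rewrite hE.
Qed.

Lemma retract_zero X Y : zero_module X -> retract X Y.
Proof.
move=> X0; exists (\0 : {linear X -> Y}), (\0 : {linear Y -> X}) => x.
by rewrite [x]X0.
Qed.

Lemma ses_prod_proj X Y : ses X (X * Y)%type Y.
Proof.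
have [h hE] := pair_lin (idfun : {linear X -> X}) (\0 : {linear X -> Y}).
exists h, snd; split.
- by move=> x y; rewrite !hE => -[].
- by move=> y; exists (0, y).
move=> [x y]; split=> [/= ->|[x' <-]]; last by rewrite hE.
by exists x; rewrite hE.
Qed.

(** A recursive form of the direct sum of n copies of X. *)
Fixpoint power X n : lmodType R :=
  if n is n'.+1 then (X * power X n')%type else 'rV[R]_0.

Lemma power0 X : zero_module (power X 0).
Proof. by move=> x; apply/rowP => -[]. Qed.

Lemma retract_prodA X Y Z : retract ((X * Y) * Z)%type (X * (Y * Z))%type.
Proof.
have [f fE] : exists f : {linear (X * (Y * Z))%type -> ((X * Y) * Z)%type},
  forall p, f p = ((p.1, p.2.1), p.2.2) by apply: linear_of.
have [g gE] : exists f : {linear ((X * Y) * Z)%type -> (X * (Y * Z))%type},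
  forall p, f p = (p.1.1, (p.1.2, p.2)) by apply: linear_of.
by exists g, f => -[[x y] z]; rewrite gE fE.
Qed.

Lemma power_add X m n : retract ((power X m) * (power X n))%type (power X (m +
  n)).
Proof.
elim: m => [|m IH] /=.
  exists (snd : {linear _ -> _}).
  have [k kE] := pair_lin (\0 : {linear power X n -> power X 0}) (idfun :
    {linear power X n -> power X n}).
  by exists k => -[x y]; rewrite kE (power0 (x : power X 0)).
apply: retract_trans (retract_prodA _ _ _) _.
by apply: retract_prod IH; exact: retract_refl.
Qed.

Lemma ses_power X Y Z n : ses X Y Z -> ses (power X n) (power Y n) (power Z n).
Proof.
move=> H; elim: n => [|n IH] /=; last exact: ses_prod.
by apply: ses_iso (@power0 Z); exact: iso_refl.
Qed.

(** Finitely many maps with no common kernel give an embedding in a power. *)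
Lemma power_map X Y n (u : 'I_n -> {linear X -> Y}) :
  exists F : {linear X -> power Y n}, forall x, F x = 0 -> forall i, u i x = 0.
Proof.
elim: n u => [|n IH] u; first by exists \0 => x _ [].
have [F FP] := IH (fun i => u (lift ord0 i)).
have [G GE] := pair_lin (u ord0) F.
exists G => x; rewrite GE => -[ux Fx] i.
by case: (unliftP ord0 i) => [j ->|->] //; apply: FP.
Qed.

(** Membership in add T; retracts replace the complements of direct summands. *)
Definition add_of T U := exists n, retract U (power T n).

Lemma add_of_refl T : add_of T T.
Proof. by exists 1; exact: retract_fst. Qed.

Lemma add_of_retract T U V : retract U V -> add_of T V -> add_of T U.
Proof. by move=> UV [n Vn]; exists n; apply: retract_trans UV Vn. Qed.

Lemma add_of_zero T U : zero_module U -> add_of T U.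
Proof. by move=> U0; exists 0; apply: retract_zero. Qed.

Lemma add_of_prod T U V : add_of T U -> add_of T V -> add_of T (U * V)%type.
Proof.
move=> [m Um] [n Vn]; exists (m + n)%N.
by apply: retract_trans (power_add T m n); exact: retract_prod.
Qed.

Lemma add_of_power T U n : add_of T U -> add_of T (power U n).
Proof.
move=> H; elim: n => [|n IH] /=; first by apply: add_of_zero;
  exact: (@power0 U).
exact: add_of_prod.
Qed.

Lemma add_of_trans T T' U : add_of T' T -> add_of T U -> add_of T' U.
Proof. by move=> TT' [n Un]; apply: add_of_retract Un _;
  exact: add_of_power. Qed.

(** * Length *)

(** The length is bounded by measuring strictly descending chains of subobjects,
    so that additivity and noetherian arguments become inductions on n without
    composition series or the Jordan-Hoelder theorem. *)
Fixpoint length_le n M : Prop :=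
  forall M' (f : {linear M' -> M}), injective f -> ~ surjective f ->
    if n is n'.+1 then length_le n' M' else False.

Definition finite_length M := exists n, length_le n M.

Lemma length_le_sub n M N (g : {linear N -> M}) : injective g ->
  length_le n M -> length_le n N.
Proof.
move=> gI; case: n => [|n] H N' f fI fS;
  (apply: (H N' (g \o f : {linear _ -> _})); first exact: inj_comp);
  move=> gfS; apply: fS => y; have [x /gI <-] := gfS (g y); by exists x.
Qed.

Lemma length_le_S n M : length_le n M -> length_le n.+1 M.
Proof.
elim: n M => [|n IH] M H N f fI fS; first by case: (H _ _ fI fS).
by apply: IH; exact: H fI fS.
Qed.

Lemma length_le_le m n M : (m <= n)%N -> length_le m M -> length_le n M.
Proof.
move=> /subnKC <-; elim: (n - m)%N => [|k IH]; first by rewrite addn0.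
by rewrite addnS => /IH; exact: length_le_S.
Qed.

Lemma length_le_zero M : zero_module M -> length_le 0 M.
Proof. by move=> M0 N f _; apply => x; exists 0; rewrite [x]M0 linear0. Qed.

Lemma length_le0 M : length_le 0 M -> zero_module M.
Proof.
move=> M0 x; have [Z Z0] := zero_module_ex; apply: contrapT => x0.
apply: (M0 Z \0) => [a b|]; first by rewrite [a]Z0 [b]Z0.
by move=> /(_ x)[z /= E]; apply: x0.
Qed.

Lemma length_le_quo n M N (g : {linear M -> N}) : surjective g ->
  length_le n M -> length_le n N.
Proof.
elim: n M N g => [|n IH] M N g gS H N' f fI fS.
all: have [M' [i [iI iP]]] := sub_module_of (preim_is_submod g (im_is_submod
  f)).
all: have iS : ~ surjective i by
  (move=> iS; apply: fS => y; have [x <-] := gS y; apply/iP; exact: iS).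
  exact: H iI iS.
have [|u uE] := @lift_lin M' N' N f (g \o i : {linear _ -> _}) fI.
  by move=> x; apply/iP; exists x.
apply: (IH M' N' u) => [y|]; last exact: H iI iS.
have [x gx] := gS (f y); have [x' ix'] : exists x', i x' = x.
  by apply/iP; exists y.
by exists x'; apply: fI; rewrite uE /= ix'.
Qed.

(** Pulling back a proper submodule of N gives a proper submodule of M which
    still meets the kernel, so the two chains can be followed in parallel. *)
Lemma length_le_quo_lt n M N (g : {linear M -> N}) x : surjective g ->
  g x = 0 -> x <> 0 -> length_le n.+1 M -> length_le n N.
Proof.
elim: n M N g x => [|n IH] M N g x gS gx x0 H N' f fI fS.
all: have [M' [i [iI iP]]] := sub_module_of (preim_is_submod g (im_is_submod
  f)).
all: have iS : ~ surjective i by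
  (move=> iS; apply: fS => y; have [z <-] := gS y; apply/iP; exact: iS).
all: have [x' ix'] : exists x', i x' = x
  by apply/iP; exists 0; rewrite gx linear0.
  have M0 := length_le0 (H M' i iI iS).
  by apply: x0; rewrite -ix' [x']M0 linear0.
have [|u uE] := @lift_lin M' N' N f (g \o i : {linear _ -> _}) fI.
  by move=> z; apply/iP; exists z.
apply: (IH M' N' u x') => [y||| ]; last exact: H iI iS.
- have [z gz] := gS (f y); have [z' iz'] : exists z', i z' = z.
    by apply/iP; exists y.
  by exists z'; apply: fI; rewrite uE /= iz'.
- by apply: fI; rewrite uE /= ix' gx linear0.
- by move=> E; apply: x0; rewrite -ix' E linear0.
Qed.

(** A submodule that contains X and maps onto Z is everything; this is what makes
    length additive. *)
Lemma ses_sub X Y Z Y' (j : {linear Y' -> Y}) : ses X Y Z -> injective j ->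
  exists X' Z' (i : {linear X' -> X}) (k : {linear Z' -> Z}),
    [/\ ses X' Y' Z', injective i, injective k
      & surjective i -> surjective k -> surjective j].
Proof.
move=> [f [g [fI gS fg]]] jI.
have [X' [f' [fI' fP']]] := sub_module_of (ker_is_submod (g \o j :
  {linear _ -> _})).
have [Z' [k [kI kP]]] := sub_module_of (im_is_submod (g \o j :
  {linear _ -> _})).
have [y|g' gE'] := @lift_lin Y' Z' Z k (g \o j : {linear _ -> _}) kI.
  by apply/kP; exists y.
have [x|i iE] := @lift_lin X' X Y f (j \o f' : {linear _ -> _}) fI.
  by apply/fg; apply/fP'; exists x.
exists X', Z', i, k; split=> //.
- exists f', g'; split=> // [z|y].
    have /kP[y E] : exists z', k z' = k z by exists z.
    by exists y; apply: kI; rewrite gE'.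
  rewrite -fP' /= -[g (j y)]/((g \o j) y) -gE'.
  by split=> [->|E]; [rewrite linear0 | apply: kI; rewrite E linear0].
- by move=> x y E; apply/fI'/jI; have /= := iE x; rewrite E iE.
move=> iS kS y; have /kP[y' /= E] := kS (g y).
have /fg[x Ex] : g (y - j y') = 0 by rewrite linearB E subrr.
have [x' ix'] := iS x; exists (f' x' + y').
by rewrite linearD; have /= <- := iE x'; rewrite ix' Ex subrK.
Qed.

Lemma length_le_ext a b X Y Z : ses X Y Z -> length_le a X -> length_le b Z ->
  length_le (a + b) Y.
Proof.
move En : (a + b)%N => n.
elim: n a b En X Y Z => [|n IH] a b En X Y Z S Xa Zb Y' j jI jS.
all: have [X' [Z' [i [k [S' iI kI ikS]]]]] := ses_sub S jI.
all: have [kS|kS] := pselect (surjective k).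
all: try have iS : ~ surjective i by (move=> iS; apply: jS; exact: ikS).
- by case: a En Xa => [|a] // _ H; case: (H _ _ iI iS).
- by case: b En Zb => [|b]; rewrite ?addnS // => _ H; case: (H _ _ kI kS).
- case: a En Xa => [|a]; first by move=> _ H; case: (H _ _ iI iS).
  move=> [En] Xa; apply: IH En _ _ _ S' (Xa _ _ iI iS) _;
    exact: length_le_sub kI Zb.
case: b En Zb => [|b]; first by move=> _ H; case: (H _ _ kI kS).
rewrite addnS => -[En] Zb.
by apply: IH En _ _ _ S' _ (Zb _ _ kI kS); exact: length_le_sub iI Xa.
Qed.

Lemma finite_length_sub M N (g : {linear N -> M}) : injective g ->
  finite_length M -> finite_length N.
Proof. by move=> gI [n H]; exists n; exact: length_le_sub gI H. Qed.

Lemma finite_length_quo M N (g : {linear M -> N}) : surjective g ->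
  finite_length M -> finite_length N.
Proof. by move=> gI [n H]; exists n; exact: length_le_quo gI H. Qed.

Lemma finite_length_ext X Y Z : ses X Y Z -> finite_length X ->
  finite_length Z -> finite_length Y.
Proof. by move=> S [a Xa] [b Zb]; exists (a + b)%N;
  exact: length_le_ext S Xa Zb. Qed.

Lemma finite_length_ses_l X Y Z : ses X Y Z -> finite_length Y ->
  finite_length X.
Proof. by move=> [f [g [fI _ _]]]; exact: finite_length_sub fI. Qed.

Lemma finite_length_ses_r X Y Z : ses X Y Z -> finite_length Y ->
  finite_length Z.
Proof. by move=> [f [g [_ gS _]]]; exact: finite_length_quo gS. Qed.

Lemma finite_length_zero X : zero_module X -> finite_length X.
Proof. by move=> X0; exists 0; exact: length_le_zero. Qed.

Lemma finite_length_prod X Y : finite_length X -> finite_length Y ->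
  finite_length (X * Y)%type.
Proof. exact: finite_length_ext (ses_prod_proj X Y). Qed.

Lemma finite_length_retract X Y : retract X Y -> finite_length Y ->
  finite_length X.
Proof. by move=> [i [r ir]]; apply: finite_length_sub (can_inj ir). Qed.

Lemma length_le_power X l n : length_le l X -> length_le (n * l) (power X n).
Proof.
move=> Xl; elim: n => [|n IH]; first by apply: length_le_zero; exact: power0.
by rewrite mulSn; apply: length_le_ext (ses_prod_proj _ _) Xl IH.
Qed.

Lemma finite_length_power X n : finite_length X -> finite_length (power X n).
Proof. by move=> [l Xl]; exists (n * l)%N; exact: length_le_power. Qed.

Lemma finite_length_add_of T U : finite_length T -> add_of T U ->
  finite_length U.
Proof. by move=> Tf [n /finite_length_retract]; apply;
  exact: finite_length_power. Qed.

(** The descending chain condition in the form used below: a non-minimal member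
    is replaced by a proper submodule, of smaller length. *)
Lemma sub_min M (P : (M -> Prop) -> Prop) : finite_length M ->
  (forall A, P A -> is_submod A) -> (exists A, P A) ->
  exists2 A, P A & forall B, P B -> (forall x, B x -> A x) -> forall x, A x ->
    B x.
Proof.
move=> [n Mn] Plin [A PA]; have [X [i [iI iP]]] := sub_module_of (Plin A PA).
have := length_le_sub iI Mn; move=> Xn; clear Mn.
elim: n A PA X i iI iP Xn => [|n IH] A PA X i iI iP Xn.
  exists A => // B PB BA x /iP[y <-].
  by rewrite [y](length_le0 Xn) linear0; case: (Plin B PB).
have [H|/existsNP[B /not_implyP[PB /not_implyP[BA /existsNP[x /not_implyP[Ax
  Bx]]]]]] := 
  pselect (forall B, P B -> (forall x, B x -> A x) -> forall x, A x -> B x).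
  by exists A.
have [X' [i' [iI' iP']]] := sub_module_of (Plin B PB).
apply: (IH B PB X' i' iI' iP').
have [y|u uE] := @lift_lin X' X M i i' iI.
  by apply/iP/BA/iP'; exists y.
apply: (Xn X' u) => [y z E|uS]; first by apply: iI'; rewrite -!uE E.
by have /iP[y yE] := Ax; have [z zE] := uS y; apply: Bx; apply/iP'; exists z;
  rewrite -uE zE.
Qed.

End LinearMaps.

(** * Pushouts and quotients of exact sequences *)

Section Homological.
Variable R : pzRingType.
Implicit Types C I K L M N P Q T U V W X Y Z : lmodType R.

Lemma ses_iso_l X X' Y Z : isomorphic X' X -> ses X Y Z -> ses X' Y Z.
Proof.
move=> /isoE[u [v [uK vK]]] [f [g [fI gS fg]]].
exists (f \o u : {linear _ -> _}), g; split=> // [|y].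
  by apply: inj_comp fI (can_inj uK).
rewrite fg; split=> -[x <-]; last by exists (u x).
by exists (v x); rewrite /= vK.
Qed.

Lemma ses_iso_r X Y Z Z' : isomorphic Z Z' -> ses X Y Z -> ses X Y Z'.
Proof.
move=> /isoE[u [v [uK vK]]] [f [g [fI gS fg]]].
exists f, (u \o g : {linear _ -> _}); split=> // [z|y].
  by have [y yE] := gS (v z); exists y; rewrite /= yE vK.
rewrite -fg /=; split=> [E|->]; last by rewrite linear0.
by rewrite -[g y]uK E linear0.
Qed.

Lemma pushout X Y X' (f : {linear X -> Y}) (i : {linear X -> X'}) :
  injective f ->
  exists Q (f' : {linear X' -> Q}) (j : {linear Y -> Q}),
    [/\ injective f',
        forall x, j (f x) = f' (i x),
        forall q, exists x' y, q = f' x' + j y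
      & forall W (u : {linear X' -> W}) (v : {linear Y -> W}),
          (forall x, u (i x) = v (f x)) ->
          exists w : {linear Q -> W},
            (forall x', w (f' x') = u x') /\ (forall y, w (j y) = v y)].
Proof.
move=> fI; have [E EE] := pair_lin i (\- f : {linear X -> Y}).
have EI : injective E.
  by move=> x y; rewrite !EE => -[_ /oppr_inj/fI].
have [Q [c [_ cS cP]]] := ses_coker EI.
have [a aE] := pair_lin (idfun : {linear X' -> X'}) (\0 : {linear X' -> Y}).
have [b bE] := pair_lin (\0 : {linear Y -> X'}) (idfun : {linear Y -> Y}).
exists Q, (c \o a : {linear _ -> _}), (c \o b : {linear _ -> _}); split.
- apply/injP => x' /= /cP[x]; rewrite EE aE => -[<- /eqP].
  by rewrite oppr_eq0 => /eqP fx; rewrite (iffLR (injP f) fI x fx) linear0.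
- move=> x /=; apply/eqP; rewrite eq_sym -subr_eq0 -linearB; apply/eqP/cP.
  by exists x; rewrite EE aE bE; congr (_, _); rewrite /= ?subr0 ?sub0r.
- move=> q; have [[x' y] <-] := cS q; exists x', y.
  by rewrite /= -linearD aE bE; congr (c (_, _)); rewrite /= ?addr0 ?add0r.
move=> W u v uv; have [F FE] := copair_lin u v.
have [|w wE] := factor_lin (h := F) cS.
  by move=> p /cP[x <-]; rewrite FE EE /= linearN uv subrr.
by exists w; split=> z; rewrite /= wE FE ?aE ?bE /= linear0 ?addr0 ?add0r.
Qed.

(** Enlarging X to a module X' of which it is a summand enlarges Y to a module of
    which Y is a summand: the retraction of X' extends to the pushout. *)
Lemma ses_pushout X Y Z X' (i : {linear X -> X'}) : ses X Y Z ->
  exists2 Y', ses X' Y' Z &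
    forall r : {linear X' -> X}, cancel i r -> retract Y Y'.
Proof.
move=> [f [g [fI gS fg]]].
have [Q [f' [j [fI' jf Qs univ]]]] := pushout i fI.
have [|g' [gf' gj]] := univ Z \0 g.
  by move=> x; apply/esym/fg; exists x.
exists Q.
  exists f', g'; split=> // [z|q].
    by have [y <-] := gS z; exists (j y).
  split=> [|[x <-]]; last by rewrite gf'.
  have [x' [y ->]] := Qs q; rewrite linearD gf' gj add0r => /fg[x <-].
  by exists (x' + i x); rewrite linearD jf.
move=> r ir; have [|w [wf wj]] := univ Y (f \o r : {linear _ -> _}) idfun.
  by move=> x /=; rewrite ir.
by exists j, w => y; rewrite wj.
Qed.

Lemma ses_third U X V Y Z : ses U X V -> ses X Y Z ->
  exists2 Q, ses U Y Q & ses V Q Z.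
Proof.
move=> [a [b [aI bS ab]]] [f [g [fI gS fg]]].
have faI : injective (f \o a : {linear _ -> _}) by apply: inj_comp fI aI.
have [Q [c [_ cS cP]]] := ses_coker faI.
exists Q; first by exists (f \o a : {linear _ -> _}), c.
have [x /ab[u <-]|s sE] := factor_lin (h := c \o f : {linear _ -> _}) bS.
  by apply/cP; exists u.
have [y /cP[u <-]|t tE] := factor_lin (h := g) cS.
  by apply/fg; exists (a u).
exists s, t; split.
- apply/injP => v; have [x <-] := bS v; rewrite sE => /cP[u /= /fI <-].
  by apply/ab; exists u.
- by move=> z; have [y <-] := gS z; exists (c y); rewrite tE.
move=> q; have [y <-] := cS q; rewrite tE; split=> [/fg[x <-]|[v]].
  by exists (b x); rewrite sE.
have [x <-] := bS v; rewrite sE => E; rewrite -tE -E tE.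
by apply/fg; exists x.
Qed.

(** * Modules built in finitely many steps *)

(** The iterated classes of T, with the finite direct sums in the definition of
    the diamond product absorbed into a single extension: all the classes are
    closed under finite direct sums. *)
Fixpoint built T n M : Prop :=
  if n is n'.+1 then
    exists Y U V, [/\ retract M Y, add_of T U, built T n' V & ses U Y V]
  else zero_module M.

Lemma built_finite_length T n M : finite_length T -> built T n M ->
  finite_length M.
Proof.
move=> Tf; elim: n M => [|n IH] M /=; first exact: finite_length_zero.
move=> [Y [U [V [MY TU /IH Vf S]]]]; apply: finite_length_retract MY _.
exact: finite_length_ext S (finite_length_add_of Tf TU) Vf.
Qed.

Lemma built_retract T n M N : retract M N -> built T n N -> built T n M.
Proof.
case: n => [|n] MN; last first.
  move=> [Y [U [V [NY TU Vb S]]]].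
  by exists Y, U, V; split=> //; exact: retract_trans MN NY.
by case: MN => i [r ir] N0 x; rewrite -[x]ir [i x]N0 linear0.
Qed.

(** Associativity of the diamond product.  The first submodule of X in add T is
    also a submodule of Y, after enlarging X and Y by a pushout, and the
    induction continues with the quotients by it. *)
Lemma built_ext T a b X Y Z : ses X Y Z -> built T a X -> built T b Z ->
  built T (a + b) Y.
Proof.
elim: a X Y Z => [|a IH] X Y Z S.
  move=> X0 Zb; apply: built_retract Zb; apply: retract_iso.
  exact: ses_zero_l X0 S.
move=> [X' [U [V [[i [r ir]] TU Vb S']]]] Zb.
have [Y' S1 /(_ r ir) YY'] := ses_pushout i S.
have [Q SU SV] := ses_third S' S1.
by exists Y', U, Q; split=> //; exact: IH SV Vb Zb.
Qed.

Lemma built_prod T n M U : add_of T U -> built T n.+1 M ->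
  built T n.+1 (M * U)%type.
Proof.
move=> TU [Y [U' [V [MY TU' Vb S]]]].
have [Z Z0] := zero_module_ex R.
exists (Y * U)%type, (U' * U)%type, (V * Z)%type; split.
- by apply: retract_prod MY (retract_refl U).
- exact: add_of_prod.
- apply: built_retract Vb; exists fst.
  have [h hE] := pair_lin (idfun : {linear V -> V}) (\0 : {linear V -> Z}).
  by exists h => -[v z]; rewrite hE /= [z]Z0.
by apply: ses_prod S _; apply: ses_iso Z0; exact: iso_refl.
Qed.

(** * Syzygies *)

Definition proj P := finite_length P /\ projective P.

Definition syzygy M K := exists2 P, proj P & ses K P M.

(** Syzygies are defined as a relation: they depend on the chosen projectives,
    and no minimal choice is made. *)
Fixpoint nth_syzygy p M K : Prop :=
  if p is p'.+1 then exists2 L, syzygy M L & nth_syzygy p' L K else isomorphic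
    M K.

Lemma projective_zero Z : zero_module Z -> projective Z.
Proof.
by move=> Z0 B C g f gS; exists \0 => x; rewrite [x]Z0 !linear0.
Qed.

Lemma projective_prod P Q : projective P -> projective Q ->
  projective (P * Q)%type.
Proof.
move=> Pp Qp B C g f gS.
have [a aE] := pair_lin (idfun : {linear P -> P}) (\0 : {linear P -> Q}).
have [b bE] := pair_lin (\0 : {linear Q -> P}) (idfun : {linear Q -> Q}).
have [h hE] := Pp B C g (f \o a : {linear _ -> _}) gS.
have [k kE] := Qp B C g (f \o b : {linear _ -> _}) gS.
have [F FE] := copair_lin h k; exists F => -[x y].
rewrite FE linearD hE kE /= -linearD aE bE; congr (f (_, _)).
  exact: addr0.
exact: add0r.
Qed.

Lemma projective_power P n : projective P -> projective (power P n).
Proof.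
move=> Pp; elim: n => [|n IH]; first by apply: projective_zero; exact: power0.
exact: projective_prod.
Qed.

Lemma projective_ring : projective (R^o : lmodType R).
Proof.
move=> B C g f gS; have [b bE] := gS (f 1).
have [h hE] : exists h : {linear R^o -> B}, forall r, h r = (r : R) *: b.
  by apply: linear_of => a x y; rewrite scalerDl scalerA.
exists h => r; rewrite hE linearZ bE -linearZ; congr (f _).
exact: mulr1.
Qed.

Lemma proj_prod P Q : proj P -> proj Q -> proj (P * Q)%type.
Proof.
by move=> [Pf Pp] [Qf Qp]; split; [exact: finite_length_prod | exact:
  projective_prod].
Qed.

Lemma horseshoe X Y Z KX PX KZ PZ : projective PZ ->
  ses X Y Z -> ses KX PX X -> ses KZ PZ Z ->
  exists2 KY, ses KY (PX * PZ)%type Y & ses KX KY KZ.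
Proof.
move=> PZp [f [g [fI gS fg]]] [a [b [aI bS ab]]] [a' [b' [aI' bS' ab']]].
have gf x : g (f x) = 0 by apply/fg; exists x.
have [h hE] := PZp _ _ g b' gS.
have [E EE] := copair_lin (f \o b : {linear _ -> _}) h.
have ES : surjective E.
  move=> y; have [q qE] := bS' (g y).
  have /fg[x xE] : g (y - h q) = 0 by rewrite linearB hE qE subrr.
  by have [p pE] := bS x; exists (p, q); rewrite EE /= pE xE subrK.
have [KY [c [cI _ cP]]] := ses_ker ES; exists KY; first by exists c, E.
have [k kE] := pair_lin a (\0 : {linear KX -> PZ}).
have [x|u uE] := lift_lin (h := k) cI.
  apply/cP; rewrite EE kE /= linear0 addr0.
  have -> : b (a x) = 0 by apply/ab; exists x.
  by rewrite linear0.
have cE y : f (b (c y).1) + h (c y).2 = 0.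
  by have /cP : exists y', c y' = c y by [exists y]; rewrite EE.
have [y|v vE] := lift_lin (h := snd \o c : {linear _ -> _}) aI'.
  apply/ab'; rewrite /= -hE; have /eqP := cE y.
  by rewrite addrC addr_eq0 => /eqP ->; rewrite linearN gf oppr0.
exists u, v; split.
- by apply/injP => x ux; have := uE x; rewrite ux linear0 kE => -[/esym/(iffLR
    (injP a) aI)].
- move=> z; have /fg[x xE] : g (h (a' z)) = 0 by rewrite hE; apply/ab';
    exists z.
  have [p pE] := bS x.
  have /cP[y yE] : E (- p, a' z) = 0.
    by rewrite EE /= !linearN pE xE addNr.
  by exists y; apply: aI'; rewrite vE /= yE.
move=> y; split=> [vy|[x <-]]; last first.
  by apply: aI'; rewrite vE /= uE kE linear0.
have c2 : (c y).2 = 0 by have := vE y; rewrite vy linear0 /= => <-.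
have := cE y; rewrite c2 linear0 addr0 => /(iffLR (injP f) fI)/ab[x xE].
exists x; apply: cI; rewrite uE kE xE /=.
by case: (c y) c2 => ? ? /= ->.
Qed.

Lemma nth_syzygy_horseshoe p X Y Z KX KZ :
  ses X Y Z -> nth_syzygy p X KX -> nth_syzygy p Z KZ ->
  exists2 KY, nth_syzygy p Y KY & ses KX KY KZ.
Proof.
elim: p X Y Z => [|p IH] X Y Z S.
  move=> XK ZK; exists Y; first exact: iso_refl.
  by apply: ses_iso_l (iso_sym XK) _; exact: ses_iso_r ZK S.
move=> [LX [PX PXp SX] KXL] [LZ [PZ PZp SZ] KZL].
have [LY SY SL] := horseshoe PZp.2 S SX SZ.
have [KY YK SK] := IH _ _ _ SL KXL KZL.
by exists KY => //; exists LY => //; exists (PX * PZ)%type => //;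
  exact: proj_prod.
Qed.

Lemma nth_syzygy_prod p X Y KX KY : nth_syzygy p X KX -> nth_syzygy p Y KY ->
  nth_syzygy p (X * Y)%type (KX * KY)%type.
Proof.
elim: p X Y => [|p IH] X Y.
  move=> /isoE[f [f' [fK fK']]] /isoE[g [g' [gK gK']]].
  have [h hE] := prod_lin f g; have [h' hE'] := prod_lin f' g'.
  by exists h, h' => -[x y]; rewrite hE hE' /= ?fK ?gK ?fK' ?gK'.
move=> [LX [PX PXp SX] KXL] [LY [PY PYp SY] KYL].
exists (LX * LY)%type; last exact: IH.
by exists (PX * PY)%type; [exact: proj_prod | exact: ses_prod].
Qed.

Lemma syzygy_zero X Z : zero_module X -> zero_module Z -> syzygy X Z.
Proof.
move=> X0 Z0; exists X; last first.
  exact: ses_iso (iso_zero_l Z0 X0) X0.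
by split; [exact: finite_length_zero | exact: projective_zero].
Qed.

Lemma nth_syzygy_zero p X Z : zero_module X -> zero_module Z ->
  nth_syzygy p X Z.
Proof.
move=> X0 Z0; elim: p => [|p IH] /=; first exact: iso_zero_l.
by exists X => //; exact: syzygy_zero.
Qed.

Lemma nth_syzygy_pad p q X Z : (p <= q)%N -> zero_module Z ->
  nth_syzygy p X Z -> nth_syzygy q X Z.
Proof.
move=> pq Z0; elim: p q pq X => [|p IH] q pq X.
  by move=> /isoE[f [g [fK _]]]; apply: nth_syzygy_zero => // {}x;
    rewrite -[x]fK [f x]Z0 linear0.
case: q pq => // q pq [L XL LZ]; exists L => //; exact: IH LZ.
Qed.

(** * Injective modules and cosyzygies *)

(** Injectivity relative to the modules of finite length. *)
Definition extends_maps I := forall X Y (f : {linear X -> Y}) (g :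
  {linear X -> I}),
  finite_length Y -> injective f -> exists h :
    {linear Y -> I}, forall x, h (f x) = g x.

Definition fg_injective I := finite_length I /\ extends_maps I.

Definition cosyzygy L C := exists2 I, fg_injective I & ses L I C.

Lemma fg_injective_prod I J : fg_injective I -> fg_injective J ->
  fg_injective (I * J)%type.
Proof.
move=> [If Ii] [Jf Ji]; split; first exact: finite_length_prod.
move=> X Y f g Yf fI.
have [h hE] := Ii X Y f (fst \o g : {linear _ -> _}) Yf fI.
have [k kE] := Ji X Y f (snd \o g : {linear _ -> _}) Yf fI.
have [F FE] := pair_lin h k; exists F => x; rewrite FE hE kE /=.
by case: (g x).
Qed.

Lemma fg_injective_zero I : zero_module I -> fg_injective I.
Proof.
move=> I0; split; first exact: finite_length_zero.
by move=> X Y f g _ _; exists \0 => x; rewrite [g x]I0.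
Qed.

Lemma fg_injective_power I n : fg_injective I -> fg_injective (power I n).
Proof.
move=> Ii; elim: n => [|n IH]; first by apply: fg_injective_zero; exact: power0.
exact: fg_injective_prod.
Qed.

Lemma cosyzygy_power L C n : cosyzygy L C -> cosyzygy (power L n) (power C n).
Proof. by move=> [I Ii S]; exists (power I n);
  [exact: fg_injective_power | exact: ses_power]. Qed.

Lemma horseshoe_injective X Y Z CX IX CZ IZ : extends_maps IX ->
  finite_length Y ->
  ses X Y Z -> ses X IX CX -> ses Z IZ CZ ->
  exists2 CY, ses Y (IX * IZ)%type CY & ses CX CY CZ.
Proof.
move=> IXi Yf [f [g [fI gS fg]]] [a [b [aI bS ab]]] [a' [b' [aI' bS' ab']]].
have gf x : g (f x) = 0 by apply/fg; exists x.
have ba x : b (a x) = 0 by apply/ab; exists x.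
have ba' x : b' (a' x) = 0 by apply/ab'; exists x.
have [h hE] := IXi _ _ f a Yf fI.
have [E EE] := pair_lin h (a' \o g : {linear _ -> _}).
have EI : injective E.
  apply/injP => y; rewrite EE => -[hy /(iffLR (injP a') aI')/fg[x xE]].
  by move: hy; rewrite -xE hE => /(iffLR (injP a) aI) ->; rewrite linear0.
have [CY [c [_ cS cP]]] := ses_coker EI; exists CY; first by exists E, c.
have [k kE] := pair_lin (idfun : {linear IX -> IX}) (\0 : {linear IX -> IZ}).
have [i /ab[x <-]|u uE] := factor_lin (h := c \o k : {linear _ -> _}) bS.
  by apply/cP; exists (f x); rewrite EE kE hE /= gf linear0.
have [p /cP[y <-]|v vE] := factor_lin (h := b' \o snd : {linear _ -> _}) cS.
  by rewrite EE /= ba'.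
exists u, v; split.
- apply/injP => w; have [i <-] := bS w; rewrite uE /= kE => /cP[y].
  rewrite EE /= => -[<- /(iffLR (injP a') aI')/fg[x <-]].
  by rewrite hE ba.
- move=> w; have [i <-] := bS' w.
  by exists (c (0, i)); rewrite vE.
move=> w; have [[i j] <-] := cS w; rewrite vE /=; split=> [/ab'[z zE]|[s]].
  have [y yE] := gS z; exists (b (i - h y)); rewrite uE /= kE.
  apply/eqP; rewrite -subr_eq0 -linearB; apply/eqP/cP; exists (- y).
  rewrite linearN EE /= yE zE; congr (_, _).
    by rewrite /= addrAC subrr add0r.
  by rewrite /= sub0r.
have [i' <-] := bS s; rewrite uE /= kE => E'.
have := vE (i, j); rewrite /= -E' => <-.
by rewrite vE /= linear0.
Qed.

(** A form of Schanuel's lemma: the maps that the inclusion and the retraction of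
    L induce on cosyzygies compose to an endomorphism of C that differs from the
    identity by a map through I, so one copy of I repairs the difference. *)
Lemma cosyzygy_retract L Y I C I' C' : fg_injective I -> finite_length I' ->
  extends_maps I' ->
  retract L Y -> ses L I C -> ses Y I' C' -> retract C (C' * I)%type.
Proof.
move=> [If Ii] If' Ii' [i [r ir]] [a [b [aI bS ab]]] [a' [b' [aI' bS' ab']]].
have [F FE] := Ii' _ _ a (a' \o i : {linear _ -> _}) If aI.
have [G GE] := Ii _ _ a' (a \o r : {linear _ -> _}) If' aI'.
have [x /ab[l <-]|F' FE'] := factor_lin (h := b' \o F : {linear _ -> _}) bS.
  by apply/ab'; exists (i l); rewrite FE.
have [x /ab'[y <-]|G' GE'] := factor_lin (h := b \o G : {linear _ -> _}) bS'.
  by apply/ab; exists (r y); rewrite GE.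
have [x|h hE] := factor_lin (h := (idfun \- (G \o F) : {linear I -> I})) bS.
  by move=> /ab[l <-]; rewrite /= FE /= GE /= ir subrr.
have [s sE] := pair_lin F' h; have [t tE] := copair_lin G' b.
exists s, t => c; have [x <-] := bS c.
by rewrite tE sE /= FE' GE' hE /= linearB addrC subrK.
Qed.

(** The pushout of P and I over L is an extension of M by I, hence split because I
    is injective.  The splitting is made explicit by an extension h : P -> I of
    L -> I: the map P -> M * I has components g and h. *)
Lemma ses_rotate L P M I C : extends_maps I -> finite_length P ->
  ses L P M -> ses L I C -> ses P (M * I)%type C.
Proof.
move=> Ii Pf [f [g [fI gS fg]]] [j [c [jI cS jc]]].
have [h hE] := Ii _ _ f j Pf fI.
have cj x : c (j x) = 0 by apply/jc; exists x.
have gf x : g (f x) = 0 by apply/fg; exists x.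
have [x /fg[l <-]|u uE] := factor_lin (h := c \o h : {linear _ -> _}) gS.
  by rewrite /= hE cj.
have [E EE] := pair_lin g h.
have [D DE] := copair_lin (\- u : {linear _ -> _}) c.
exists E, D; split.
- apply/injP => x; rewrite EE => -[/fg[l <-]]; rewrite hE.
  by move=> /(iffLR (injP j) jI) ->; rewrite linear0.
- by move=> w; have [i <-] := cS w; exists (0, i);
    rewrite DE /= linear0 oppr0 add0r.
move=> [m i]; rewrite DE /=; split=> [|[x]]; last first.
  by rewrite EE => -[<- <-]; rewrite uE addNr.
have [x <-] := gS m; rewrite uE /= => /eqP; rewrite addrC subr_eq0 => /eqP ci.
have /jc[l lE] : c (i - h x) = 0 by rewrite linearB ci subrr.
by exists (x + f l); rewrite EE !linearD gf addr0 hE lE addrC subrK.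
Qed.

Section Cogenerator.
Variable I0 : lmodType R.
Hypothesis I0i : fg_injective I0.
Hypothesis I0c : forall L, finite_length L ->
  exists r (f : {linear L -> power I0 r}), injective f.

Lemma fg_injective_add_of I : fg_injective I -> add_of I0 I.
Proof.
move=> [If Ii]; have [r [f fI]] := I0c If; exists r.
have [|h hE] := Ii _ _ f idfun _ fI; first by case: (fg_injective_power r I0i).
by exists f, h.
Qed.

Lemma cosyzygy_ex L : finite_length L -> exists C, cosyzygy L C.
Proof.
move=> Lf; have [r [f fI]] := I0c Lf; have [C [g S]] := ses_coker fI.
by exists C, (power I0 r); [exact: fg_injective_power | exists f, g].
Qed.

Lemma cosyzygy_finite_length L C : cosyzygy L C -> finite_length C.
Proof. by move=> [I [If _] S]; exact: finite_length_ses_r S If. Qed.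

(** Cosyzygies turn exact sequences into exact sequences by the dual horseshoe
    lemma; the injectives that appear on the way all lie in add I0. *)
Lemma built_cosyzygy T T' CT n L : finite_length T -> add_of T' I0 ->
  cosyzygy T CT -> add_of T' CT ->
  built T n L -> exists2 C, cosyzygy L C & built T' n C.
Proof.
move=> Tf T'I TC T'C; elim: n L => [|n IH] L.
  move=> L0; exists L => //; exists L; first exact: fg_injective_zero.
  by apply: ses_iso L0; exact: iso_refl.
move=> Lb; have Lf := built_finite_length Tf Lb.
case: Lb => [Y [U [V [LY TU Vb S]]]].
have Uf := finite_length_add_of Tf TU.
have Yf := finite_length_ext S Uf (built_finite_length Tf Vb).
have [CV [IV IVi SV] CVb] := IH V Vb.
have [CU [IU IUi SU]] := cosyzygy_ex Uf.
have [CL [IL ILi SL]] := cosyzygy_ex Lf.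
have [CY SY SC] := horseshoe_injective IUi.2 Yf S SU SV.
exists CL; first by exists IL.
have T'J J : fg_injective J -> add_of T' J by move=> /fg_injective_add_of;
  exact: add_of_trans.
have IUVi := fg_injective_prod IUi IVi.
apply: built_retract (cosyzygy_retract ILi IUVi.1 IUVi.2 LY SL SY) _.
apply: built_prod; first exact: T'J.
exists CY, CU, CV; split=> //; first exact: retract_refl.
case: TU => r Ur; have [J [Jf Ji] SJ] := cosyzygy_power r TC.
apply: add_of_retract (cosyzygy_retract IUi Jf Ji Ur SU SJ) _.
by apply: add_of_prod; [exact: add_of_power | exact: T'J].
Qed.

End Cogenerator.

End Homological.

(** * Simple and monolithic modules *)

Section FiniteLength.
Variable R : pzRingType.
Implicit Types C I K L M N P Q T U V W X Y Z : lmodType R.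

Lemma nonzeroP M : ~ zero_module M -> exists x : M, x <> 0.
Proof. by move=> /existsNP. Qed.

Lemma finite_length_fgen M : finite_length M -> fgen M.
Proof.
move=> [n]; elim: n M => [|n IH] M Mn.
  exists 0, (fun=> 0) => x; exists (fun=> 0).
  by rewrite big_ord0; exact: length_le0 Mn x.
have [M0|/nonzeroP[x x0]] := pselect (zero_module M).
  by exists 0, (fun=> 0) => y; exists (fun=> 0); rewrite big_ord0; exact: M0.
have [Q [g [gS gP]]] := quotient_of (line_is_submod x).
have gx : g x = 0 by apply/gP; exists 1; rewrite scale1r.
have [m [e eP]] := IH Q (length_le_quo_lt gS gx x0 Mn).
have [e' e'P] := choice (fun i => gS (e i)).
exists m.+1, (fun i => if unlift ord0 i is Some j then e' j else x) => y.
have [c cE] := eP (g y).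
have /gP[a aE] : g (y - \sum_i c i *: e' i) = 0.
  rewrite linearB linear_sum cE; apply/eqP; rewrite subr_eq0; apply/eqP.
  by apply: eq_bigr => i _; rewrite linearZ e'P.
exists (fun i => if unlift ord0 i is Some j then c j else a).
rewrite big_ord_recl unlift_none -aE.
rewrite -[LHS](subrK (\sum_i c i *: e' i)); congr (_ + _).
by apply: eq_bigr => i _; rewrite liftK.
Qed.

Lemma fgen_cover M : fgen M ->
  exists n (g : {linear power (R^o : lmodType R) n -> M}), surjective g.
Proof.
move=> [n [e eP]]; exists n.
suff [g gE] : exists g : {linear power (R^o : lmodType R) n -> M},
    forall c : 'I_n -> R, exists y, g y = \sum_i c i *: e i.
  by exists g => x; have [c ->] := eP x; have [y <-] := gE c; exists y.
clear eP; elim: n e => [|n IH] e.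
  by exists \0 => c; exists 0; rewrite big_ord0.
have [g gE] := IH (fun i => e (lift ord0 i)).
have [h hE] : exists h : {linear (R^o : lmodType R) -> M}, forall r, h r = (r :
  R) *: e ord0.
  by apply: linear_of => a x y; rewrite scalerDl scalerA.
have [k kE] := copair_lin h g; exists k => c.
have [y yE] := gE (fun i => c (lift ord0 i)).
by exists (c ord0, y); rewrite kE hE big_ord_recl yE.
Qed.

Lemma simpleP M : simple_module M <->
  (exists x : M, x <> 0) /\
  forall A : M -> Prop, is_submod A -> (forall x, A x ->
    x = 0) \/ (forall x, A x).
Proof.
split=> -[[x x0] H]; split.
- by exists x; exact/eqP.
- by move=> A /submod_of[N NA]; have [N0|NT] := H N;
    [left=> y /NA/N0 | right=> y; apply/NA].
- by exists x; exact/eqP.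
- by move=> N; apply: H; exact: mem_is_submod.
Qed.

Lemma simple_gen T (t0 t : T) : simple_module T -> t0 <> 0 ->
  exists a : R, t = a *: t0.
Proof.
move=> /simpleP[_ H] t00; have [l0|//] := H _ (line_is_submod t0).
by case: t00; apply: l0; exists 1; rewrite scale1r.
Qed.

Lemma simple_iso T T' : isomorphic T T' -> simple_module T -> simple_module T'.
Proof.
move=> /isoE[f [g [fK gK]]] /simpleP[[x x0] H]; apply/simpleP; split.
  by exists (f x) => fx; apply: x0; rewrite -[x]fK fx linear0.
move=> A Alin; have [A0|AT] := H _ (preim_is_submod f Alin).
  by left=> y Ay; rewrite -[y]gK (A0 (g y)) ?linear0 ?gK.
by right=> y; rewrite -[y]gK.
Qed.

Lemma simple_surj M T (f : {linear M -> T}) : simple_module T ->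
  (exists x, f x <> 0) -> surjective f.
Proof.
move=> /simpleP[_ H] [x fx]; have [f0|//] := H _ (im_is_submod f).
by case: fx; apply: f0; exists x.
Qed.

Lemma simple_inj T M (f : {linear T -> M}) : simple_module T ->
  (exists x, f x <> 0) -> injective f.
Proof.
move=> /simpleP[_ H] [x fx]; have [f0|f0] := H _ (ker_is_submod f);
  first exact/injP.
by case: fx.
Qed.

Lemma simple_length_le T : simple_module T -> length_le 1 T.
Proof.
move=> /simpleP[_ H] M f fI fS; apply: length_le_zero => x.
have [f0|//] := H _ (im_is_submod f).
by apply: (iffLR (injP f)) => //; apply: f0; exists x.
Qed.

Lemma simple_finite_length T : simple_module T -> finite_length T.
Proof. by move=> /simple_length_le; exists 1. Qed.

Lemma simple_quo M : finite_length M -> ~ zero_module M ->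
  exists T (g : {linear M -> T}), simple_module T /\ surjective g.
Proof.
move=> [n]; elim: n M => [|n IH] M Mn M0; first by case: M0; exact: length_le0.
have [Ms|Ms] := pselect (simple_module M).
  by exists M, idfun; split=> // x; exists x.
have [A [Alin [x [Ax x0]] [y Ay]]] : exists A : M -> Prop,
    [/\ is_submod A, exists x, A x /\ x <> 0 & exists y, ~ A y].
  apply: contrapT => H; apply/Ms/simpleP; split; first exact: nonzeroP.
  move=> A Alin; apply: contrapT => /not_orP[/existsNP[x /not_implyP[Ax x0]]
    /existsNP[y Ay]].
  by apply: H; exists A; split=> //; [exists x | exists y].
have [Q [g [gS gP]]] := quotient_of Alin.
have gx : g x = 0 by apply/gP.
have [|T [h [Ts hS]]] := IH Q (length_le_quo_lt gS gx x0 Mn).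
  by move=> Q0; apply: Ay; apply/gP; exact: Q0.
exists T, (h \o g : {linear _ -> _}); split=> // t.
by have [q <-] := hS t; have [z <-] := gS q; exists z.
Qed.

(** The nonzero element s lies in all nonzero submodules, that is, X has a simple
    essential socle, generated by s. *)
Definition monolith X (s : X) := s <> 0 /\
  forall A : X -> Prop, is_submod A -> (exists x, A x /\ x <> 0) -> A s.

(** Divide out submodules that avoid x as long as there are any. *)
Lemma monolith_quo M (x : M) : finite_length M -> x <> 0 ->
  exists Q (g : {linear M -> Q}), surjective g /\ monolith (g x).
Proof.
move=> [n]; elim: n M x => [|n IH] M x Mn x0; first by case: x0;
  exact: length_le0.
have [Ms|Ms] := pselect (monolith x).
  by exists M, idfun; split=> // y; exists y.
have [A [Alin [y [Ay y0]] Ax]] : exists A : M -> Prop,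
    [/\ is_submod A, exists y, A y /\ y <> 0 & ~ A x].
  apply: contrapT => H; apply: Ms; split=> // A Alin [y Ay].
  by apply: contrapT => Ax; apply: H; exists A; split=> //; exists y.
have [Q [g [gS gP]]] := quotient_of Alin.
have gy : g y = 0 by apply/gP.
have [|Q' [h [hS hm]]] := IH Q (g x) (length_le_quo_lt gS gy y0 Mn).
  by move=> /gP.
exists Q', (h \o g : {linear _ -> _}); split=> // t.
by have [q <-] := hS t; have [z <-] := gS q; exists z.
Qed.

(** To extend g : X -> I along X -> Y, retract the pushout of Y and I onto I. *)
Lemma retract_extends_maps I : finite_length I ->
  (forall Z (j : {linear I -> Z}), finite_length Z -> injective j ->
     exists r : {linear Z -> I}, cancel j r) -> extends_maps I.
Proof.
move=> If H X Y f g Yf fI.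
have [Q [f' [j [fI' jf Qs _]]]] := pushout g fI.
have [F FE] := copair_lin f' j.
have [|r rK] := H Q f' _ fI'.
  apply: (@finite_length_quo _ (I * Y)%type _ F);
    last exact: finite_length_prod.
  by move=> q; have [x [y ->]] := Qs q; exists (x, y); rewrite FE.
by exists (r \o j : {linear _ -> _}) => x /=; rewrite jf rK.
Qed.

(** The product of one choice for every index serves all indices at once. *)
Lemma uniform_bound_module (Phi : lmodType R -> Prop) n (Psi : 'I_n ->
  lmodType R -> Prop) :
  (forall Z, zero_module Z -> Phi Z) ->
  (forall Y Z, Phi Y -> Phi Z -> Phi (Y * Z)%type) ->
  (forall i, exists2 Z, Phi Z & Psi i Z) ->
  exists2 Z, Phi Z & forall i, exists2 Y, Psi i Y & retract Y Z.
Proof.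
move=> Phi0 PhiP; elim: n Psi => [|n IH] Psi H.
  by have [Z Z0] := zero_module_ex R; exists Z; [exact: Phi0 | case].
have [Z1 P1 H1] := IH (fun i => Psi (lift ord0 i)) (fun i => H _).
have [Z0 P0 H0] := H ord0.
exists (Z0 * Z1)%type; first exact: PhiP.
move=> i; case: (unliftP ord0 i) => [j ->|->].
  have [Y YP Yr] := H1 j; exists Y => //.
  exact: retract_trans Yr (retract_snd _ _).
by exists Z0 => //; exact: retract_fst.
Qed.

(** A simple quotient of M is a quotient of a maximal submodule N of M, or it
    is M / N. *)
Lemma simple_factors M : finite_length M ->
  exists n (V : 'I_n -> lmodType R), (forall i, simple_module (V i)) /\
    forall T (f : {linear M -> T}), simple_module T -> (exists x, f x <> 0) ->
      exists i, isomorphic (V i) T.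
Proof.
move=> [n]; elim: n M => [|n IH] M Mn.
  exists 0, (fun=> M); split=> [[]//|T f _ [x]].
  by rewrite (length_le0 Mn x) linear0.
have [M0|M0] := pselect (zero_module M).
  exists 0, (fun=> M); split=> [[]//|T f _ [x]].
  by rewrite (M0 x) linear0.
have [T0 [g [Ts gS]]] := simple_quo (ex_intro _ n.+1 Mn) M0.
have [N [i [iI _ iP]]] := ses_ker gS.
have [|m [V [Vs VP]]] := IH N.
  apply: Mn iI _ => iS; have [[t t0] _] := iffLR (simpleP _) Ts.
  by case: t0; have [x <-] := gS t; apply/iP; exact: iS.
exists m.+1, (fun i => if unlift ord0 i is Some j then V j else T0); split.
  by move=> j; case: (unlift ord0 j).
move=> T f Tsim fx.
have [[y fy]|H] := pselect (exists y, f (i y) <> 0).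
  have [|j jP] := VP T (f \o i : {linear _ -> _}) Tsim; first by exists y.
  by exists (lift ord0 j); rewrite liftK.
have [x|u uE] := factor_lin (h := f) gS.
  move=> /iP[y <-]; apply: contrapT => fy; apply: H; by exists y.
exists ord0; rewrite unlift_none.
have ux : exists x, u x <> 0 by have [x ?] := fx; exists (g x); rewrite uE.
by apply: (@inj_surj_iso _ _ _ u); [exact: simple_inj | exact: simple_surj].
Qed.

End FiniteLength.

(** * Enough injectives *)

Section EnoughInjectives.
Variable R : pzRingType.
Implicit Types C I K L M N P Q T U V W X Y Z : lmodType R.
Hypothesis RF : finite_length (R^o : lmodType R).

Lemma fgen_finite_length M : fgen M -> finite_length M.
Proof. by move=> /fgen_cover[n [g gS]]; apply: finite_length_quo gS _;
  exact: finite_length_power. Qed.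

Lemma syzygy_ex M : finite_length M -> exists K, syzygy M K.
Proof.
move=> /finite_length_fgen/fgen_cover[n [g gS]]; have [K [f S]] := ses_ker gS.
exists K, (power R^o n); last by exists f, g.
by split; [exact: finite_length_power | apply: projective_power;
  exact: projective_ring].
Qed.

Lemma nth_syzygy_ex p M : finite_length M -> exists2 K,
  finite_length K & nth_syzygy p M K.
Proof.
elim: p M => [|p IH] M Mf; first by exists M => //; exact: iso_refl.
have [L SL] := syzygy_ex Mf; have [P [Pf _] S] := SL.
by have [K Kf KL] := IH L (finite_length_ses_l S Pf); exists K => //; exists L.
Qed.

Lemma proj_add_of P : proj P -> add_of (R^o : lmodType R) P.
Proof.
move=> [/finite_length_fgen/fgen_cover[n [g gS]] Pp]; exists n.
by have [h hE] := Pp _ _ g idfun gS; exists h, g.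
Qed.

Lemma simple_list : exists n (V : 'I_n -> lmodType R),
  (forall i, simple_module (V i)) /\
  forall T, simple_module T -> exists i, isomorphic (V i) T.
Proof.
have [n [V [Vs VP]]] := simple_factors RF; exists n, V; split=> // T Ts.
have [[t t0] _] := iffLR (simpleP _) Ts.
have [h hE] : exists h : {linear (R^o : lmodType R) -> T}, forall r, h r = (r :
  R) *: t.
  by apply: linear_of => a x y; rewrite scalerDl scalerA.
by apply: (VP T h Ts); exists 1; rewrite hE scale1r.
Qed.

Variable B : nat.
Hypothesis bound : forall X (s : X), finite_length X -> monolith s ->
  length_le B X.

(** Among the monolithic extensions of T take Y of maximal length.  Whenever Y
    embeds in Z, some quotient of Z is monolithic with the same monolith; it
    contains Y, so by maximality it is Y, and Y is a retract of Z. *)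
Lemma simple_envelope T : simple_module T ->
  exists2 I, fg_injective I & exists f : {linear T -> I}, injective f.
Proof.
move=> Ts; have [[t t0] tT] := iffLR (simpleP _) Ts.
pose env n := forall Y (f : {linear T -> Y}), finite_length Y ->
  monolith (f t) -> length_le n Y.
have envB : `[<env B>] by apply/asboolP => Y f Yf; exact: bound Yf.
case: (ex_minnP (ex_intro (fun n => `[<env n>]) B envB)) => n /asboolP envn
  nmin.
have mt : monolith (idfun t).
  split=> // A Alin [x [Ax x0]]; have [A0|//] := tT A Alin.
  by case: x0; exact: A0.
case: n envn nmin => [|n] envn nmin.
  by case: t0; apply: (length_le0 (envn T idfun (simple_finite_length Ts) mt)).
have [Y [f [Yf fm Yn]]] : exists Y (f : {linear T -> Y}),
    [/\ finite_length Y, monolith (f t) & ~ length_le n Y].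
  apply: contrapT => H; suff /nmin : `[<env n>] by rewrite ltnn.
  by apply/asboolP => Y f Yf fm; apply: contrapT => Yn; apply: H; exists Y, f.
exists Y; last by exists f; apply: simple_inj Ts _; exists t; case: fm.
split=> //; apply: retract_extends_maps => // Z j Zf jI.
have [|Q [g [gS gm]]] := @monolith_quo _ Z (j (f t)) Zf.
  by move=> /(iffLR (injP j) jI); case: fm.
have gjI : injective (g \o j : {linear Y -> Q}).
  apply/injP => y gjy; apply: contrapT => y0; case: gm => + _; apply.
  case: fm => _ /(_ _ (ker_is_submod (g \o j : {linear Y -> Q}))); apply.
  by exists y.
have Qn : length_le n.+1 Q := envn Q (g \o (j \o f) :
  {linear _ -> _}) (finite_length_quo gS Zf) gm.
have gjS : surjective (g \o j : {linear Y -> Q}).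
  by apply: contrapT => /(Qn _ _ gjI).
have [h [hK _]] := iso_lin gjI gjS.
by exists (h \o g : {linear _ -> _}).
Qed.

(** The product I0 of the envelopes of the simples separates points: for x <> 0 a
    simple quotient of R x embeds in I0, and the map R x -> I0 extends.
    By the descending chain condition finitely many maps to I0 suffice. *)
Lemma cogenerator : exists2 I0, fg_injective I0 &
  forall L, finite_length L -> exists r (f : {linear L -> power I0 r}),
    injective f.
Proof.
have [n [V [Vs VP]]] := simple_list.
have [I0 I0i I0V] := uniform_bound_module (@fg_injective_zero R)
  (@fg_injective_prod R) (fun i => simple_envelope (Vs i)).
exists I0 => // L Lf.
have sep x : x <> 0 -> exists f : {linear L -> I0}, f x <> 0.
  move=> x0; have [N [i [iI iP]]] := sub_module_of (line_is_submod x).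
  have [y yE] : exists y, i y = x by apply/iP; exists 1; rewrite scale1r.
  have [||T [g [Ts gS]]] := @simple_quo _ N; first exact:
    finite_length_sub iI Lf.
    by move=> N0; apply: x0; rewrite -yE [y]N0 linear0.
  have gy : g y <> 0.
    move=> gy; have [[t t0] _] := iffLR (simpleP _) Ts; apply: t0.
    have [z <-] := gS t; have [a aE] : exists a, i z = a *: x by apply/iP;
      exists z.
    have -> : z = a *: y by apply: iI; rewrite aE linearZ yE.
    by rewrite linearZZ gy scaler0.
  have [j /isoE[_ [u [_ /can_inj uI]]]] := VP T Ts.
  have [I [v vI] [w [w' ww']]] := I0V j.
  have [f fE] := I0i.2 _ _ i (w \o (v \o (u \o g)) : {linear _ -> _}) Lf iI.
  exists f; rewrite -yE fE /= => /(iffLR (injP w) (can_inj ww')).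
  by move=> /(iffLR (injP v) vI)/(iffLR (injP u) uI).
pose P A := exists r (f : {linear L -> power I0 r}), forall x, A x <-> f x = 0.
have [||A [r [f fA]] Amin] := @sub_min _ L P Lf.
- move=> A [r [f fA]]; have [k0 kD] := ker_is_submod f.
  by split=> [|a x y]; rewrite !fA //; exact: kD.
- by exists (fun=> True), 0, \0.
exists r, f; apply/injP => x fx; apply: contrapT => /sep[h hx].
have [F FE] := pair_lin h f.
apply: hx; suff : F x = 0 by rewrite FE => -[].
apply: (Amin (fun y => F y = 0)); [by exists r.+1, F| |exact/fA].
by move=> y; rewrite FE => -[_ fy]; apply/fA.
Qed.

(** One step per syzygy: by induction the first syzygy L is built in p + n steps,
    then so is its cosyzygy, and M is one step away from that. *)
Lemma built_from_syzygy p n T : finite_length T ->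
  exists2 T', finite_length T' &
  forall M K, finite_length M -> nth_syzygy p M K -> built T n K ->
    built T' (p + n) M.
Proof.
have [I0 I0i I0c] := cogenerator.
move=> Tf; elim: p => [|p [T1 T1f IH]].
  by exists T => // M K _ MK Kb; apply: built_retract Kb; exact: retract_iso.
have [C1 SC1] := cosyzygy_ex I0i I0c T1f.
exists (R^o * (I0 * C1))%type.
  by do 2?[apply: finite_length_prod] => //; [exact: I0i.1 | exact:
    cosyzygy_finite_length SC1].
set T' := (R^o * (I0 * C1))%type.
have [aR aI aC] : [/\ add_of T' R^o, add_of T' I0 & add_of T' C1].
  split; apply: add_of_retract (add_of_refl _).
  - exact: retract_fst.
  - exact: retract_trans (retract_fst _ _) (retract_snd _ _).
  - exact: retract_trans (retract_snd _ _) (retract_snd _ _).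
move=> M K Mf [L [P Pp S] LK] Kb.
have Lb := IH L K (finite_length_ses_l S Pp.1) LK Kb.
have [C [I [If Ii] SI] Cb] := built_cosyzygy I0i I0c T1f aI SC1 aC Lb.
exists (M * I)%type, P, C; split=> //; first exact: retract_fst.
  by apply: add_of_trans aR _; exact: proj_add_of.
exact: ses_rotate Ii Pp.1 S SI.
Qed.

End EnoughInjectives.

(** * Artin algebras *)

Section Artinian.

(** A family without a minimal member contains an infinite descending chain, by
    dependent choice. *)
Lemma artinian_min (R : pzRingType) (M : lmodType R) (P : (M -> Prop) -> Prop) :
  artinian_module M -> (forall A, P A -> is_submod A) -> (exists A, P A) ->
  exists2 A, P A & forall B, P B -> (forall x, B x -> A x) -> forall x, A x ->
    B x.
Proof.
move=> art Plin [A0 PA0]; apply: contrapT => H.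
have next (A : {A | P A}) : exists B : {A | P A},
    (forall x, sval B x -> sval A x) /\ exists x, sval A x /\ ~ sval B x.
  case: A => A PA; apply: contrapT => HA; apply: H; exists A => // B PB BA x Ax.
  apply: contrapT => Bx; apply: HA; exists (exist _ B PB); split=> //=.
  by exists x.
have [s sP] := choice next.
pose a n := iter n s (exist _ A0 PA0).
have [N NP] := choice (fun n => submod_of (Plin _ (proj2_sig (a n)))).
have [|n nP] := art N.
  by move=> n x /NP ax; apply/NP; exact: (sP (a n)).1.
have [_ [x [ax nax]]] := sP (a n); apply: nax.
by apply/(NP n.+1); rewrite nP //; apply/NP.
Qed.

Variable k : comNzRingType.

(** Hopkins' theorem for commutative rings.  Let I be minimal among the ideals with
    k / I of finite length and suppose I <> 0.  Let J be minimal with I J <> 0, let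
    x in J with I x <> 0, and let L be the annihilator of I x; by minimality
    of J it is a maximal ideal.  The nonzero module I x is a vector space over
    k / L and a quotient of I, hence I has a proper submodule A with I / A
    simple.  Then k / A has finite length, a contradiction. *)
Lemma artinian_finite_length : artinian_module k^o ->
  finite_length (k^o : lmodType k).
Proof.
move=> art.
pose P (I : k -> Prop) := exists (Q : lmodType k) (g :
  {linear (k^o : lmodType k) -> Q}),
  [/\ surjective g, finite_length Q & forall x, I x <-> g x = 0].
have Plin I : P I -> @is_submod _ (k^o : lmodType k) I.
  move=> [Q [g [_ _ IP]]]; have [k0 kD] := ker_is_submod g.
  by split=> [|a x y]; rewrite !IP //; exact: kD.
have [|I PI Imin] := artinian_min art Plin.
  have [Z Z0] := zero_module_ex k; exists (fun=> True), Z, \0; split=> //.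
  - by move=> z; exists 0; rewrite [z]Z0.
  - exact: finite_length_zero.
have Ilin := Plin I PI.
have mulI a y : I y -> I (a * y) := @is_submodZ _ (k^o : lmodType k) I a y Ilin.
case: (PI) => QI [gI [gIS QIf gIP]].
have [I0|] := pselect (forall x, I x -> x = 0).
  by apply: finite_length_sub QIf; apply/injP => x /gIP/I0.
move=> /existsNP[i1 /not_implyP[Ii1 i10]]; exfalso.
pose PJ (J : k -> Prop) := @is_submod _ (k^o : lmodType k) J /\
  exists i x, [/\ I i, J x & i * x <> 0].
have [||J [Jlin [i0 [x [Ii0 Jx i0x]]]] Jmin] :=
  @artinian_min _ (k^o : lmodType k) PJ art.
- by move=> ? [].
- by exists (fun=> True); split=> //; exists i1, 1; rewrite mulr1.
(* Minimality of J: whatever does not annihilate I x acts invertibly on x. *)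
have inv r i : I i -> i * (r * x) <> 0 -> exists t, x = t * (r * x).
  move=> Ii irx; have Hl := @line_is_submod _ (k^o : lmodType k) (r * x).
  have [||t tE] := Jmin (fun y => exists a, y = a * (r * x)) _ _ x Jx.
  - by split; [exact: Hl | exists i, (r * x); split=> //; exists 1;
      rewrite mul1r].
  - by move=> y [a ->]; rewrite mulrA; exact: (@is_submodZ _ (k^o :
      lmodType k) J).
  - by exists t.
pose I1 i := I i /\ i * x = 0.
have I1lin : @is_submod _ (k^o : lmodType k) I1.
  split=> [|a y z [Iy yx] [Iz zx]].
    by split; [case: Ilin | exact: mul0r].
  split; first by apply: Ilin.2.
  by rewrite mulrDl -[a *: y]/(a * y) -mulrA yx zx mulr0 addr0.
(* The empty chain has an empty union, so members are only asked to be
   submodules together with I1. *)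
pose PA (A : set k) := [/\ @is_submod _ (k^o :
  lmodType k) (fun y => A y \/ I1 y),
  forall y, A y -> I y & ~ A i0].
have [F FP Ftot|A0 [[A0lin A0I A0i] A0max]] := @Zorn_bigcup k PA.
  split=> [|y [A FA Ay]|[A FA Ai]].
  - split=> [|a y z]; first by right; case: I1lin.
    move=> [[A FA Ay]|I1y] [[A' FA' Az]|I1z].
    + have [AA|AA] := Ftot _ _ FA FA'; [have [AL _ _] :=
      FP _ FA'|have [AL _ _] := FP _ FA].
      * have [] := AL.2 a y z; [left; exact: AA|by left| |by right].
        by left; exists A'.
      * have [] := AL.2 a y z; [by left|left; exact: AA| |by right].
        by left; exists A.
    + have [AL _ _] := FP _ FA; have [] := AL.2 a y z;
      [by left|by right| |by right].
      by left; exists A.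
    + have [AL _ _] := FP _ FA'; have [] := AL.2 a y z;
      [by right|by left| |by right].
      by left; exists A'.
    by right; apply: I1lin.2.
  - by have [_ AI _] := FP _ FA; exact: AI.
  by have [_ _ ] := FP _ FA.
pose A y := A0 y \/ I1 y.
have AI y : A y -> I y by move=> [/A0I|[]].
have Ai : ~ A i0 by move=> [//|[_ /i0x]].
have Amax (A' : k -> Prop) : @is_submod _ (k^o : lmodType k) A' ->
    (forall y, A y -> A' y) -> (forall y, A' y -> I y) ->
      (exists y, A' y /\ ~ A y) -> A' i0.
  move=> A'lin AA' A'I [y [A'y Ay]]; apply: contrapT => A'i.
  apply: (A0max A').
    split; last by move=> A'A0; apply: Ay; left; exact: A'A0.
    by move=> z A0z; apply: AA'; left.
  split=> //; have E : (fun y0 => A' y0 \/ I1 y0) = A'.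
    apply: funext => z; apply: propext; split=> [[//|I1z]|]; last by left.
    by apply: AA'; right.
  by rewrite E.
(* The maximal A and i0 together span I, since L z lies in I1 for z in I. *)
have gen z : I z -> exists a t, A a /\ z = a + t * i0.
  move=> Iz; have [Az|Az] := pselect (A z).
    by exists z, 0; rewrite mul0r addr0.
  have Hl := @line_is_submod _ (k^o : lmodType k) z.
  have [|||a [y [Aa [r rE] i0E]]] := Amax _ (add_is_submod A0lin Hl).
  - move=> y Ay; exists y, 0; split=> //; last by rewrite addr0.
    by exists 0; rewrite scale0r.
  - move=> y [a [b [Aa [r ->] ->]]].
    by rewrite -[r *: z]/(r * z) addrC; apply: Ilin.2 => //; exact: AI.
  - exists z; split=> //; exists 0, z; split; [by case: A0lin|by exists 1;
      rewrite scale1r|].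
    by rewrite add0r.
  have rzx : z * (r * x) <> 0.
    move=> rzx; apply: Ai; rewrite i0E; apply: (@is_submodD _ (k^o :
      lmodType k) A) => //.
    right; rewrite rE -[r *: z]/(r * z); split.
      exact: mulI.
    by rewrite mulrAC mulrC.
  have [t tE] := inv r z Iz rzx.
  exists ((z - t * (r * z)) - t * a), t; split.
    apply: (@is_submodB _ (k^o : lmodType k) A) => //; last first.
      exact: (@is_submodZ _ (k^o : lmodType k) A).
    right; split.
      by apply: (@is_submodB _ (k^o : lmodType k) I) => //; exact/mulI/mulI.
    rewrite mulrBl {1}tE; apply/eqP; rewrite subr_eq0; apply/eqP.
    by rewrite !mulrA (mulrC z t) -!mulrA (mulrCA z r x).
  by rewrite i0E rE -[r *: z]/(r * z) mulrDr addrA subrK subrK.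
have [Q [g [gS gP]]] := quotient_of A0lin.
have [y /gP/AI/gIP//|h hE] := factor_lin (h := gI) gS.
have hS : surjective h by move=> q; have [y <-] := gIS q; exists (g y);
  rewrite hE.
have [N [j [jI _ jP]]] := ses_ker hS.
have Nf : finite_length N.
  exists 1%N => N' f fI fS; apply: length_le_zero => n';
    apply: contrapT => n'0; apply: fS => n.
  have jfI : injective (j \o f : {linear _ -> _}) by apply: inj_comp.
  have [y yE] := gS (j (f n')).
  have imI z n1 : g z = j n1 -> I z by move=> E; apply/gIP; rewrite -hE E;
    apply/jP; exists n1.
  pose A' z := I z /\ exists n1, j (f n1) = g z.
  have A'lin : @is_submod _ (k^o : lmodType k) A'.
    apply: cap_is_submod => //.
    exact: (preim_is_submod g (im_is_submod (j \o f : {linear _ -> _}))).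
  have [|||Ii [n1 n1E]] := Amax A' A'lin.
  - move=> z Az; split; first exact: AI.
    by exists 0; rewrite !linear0; apply/esym/gP.
  - by move=> z [].
  - exists y; split; first by split; [exact: imI yE | exists n'].
    move=> /gP; rewrite yE => E.
    by apply/n'0/(iffLR (injP _) jfI).
  have [z zE] := gS (j n); have [a [t [/gP ga zE']]] := gen z (imI _ _ zE).
  exists (t *: n1); apply: jI; rewrite -zE zE' linearD ga add0r.
  by rewrite -[t * i0]/(t *: (i0 : k^o)) !linearZZ n1E.
have Qf : finite_length Q by apply: finite_length_ext Nf QIf; exists j, h.
apply: Ai; apply: (Imin A) Ii0; last exact: AI.
by exists Q, g; split=> // y; rewrite gP.
Qed.

Lemma simple_sub (M : lmodType k) : finite_length M -> ~ zero_module M ->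
  exists (T : lmodType k) (f : {linear T -> M}), simple_module T /\ injective f.
Proof.
move=> Mf /nonzeroP[x x0].
pose P (A : M -> Prop) := is_submod A /\ exists x, A x /\ x <> 0.
have [||A [Alin [y [Ay y0]]] Amin] := @sub_min _ M P Mf.
- by move=> ? [].
- by exists (fun=> True); split=> //; exists x.
have [T [f [fI fP]]] := sub_module_of Alin; exists T, f; split=> //.
apply/simpleP; split.
  have /fP[t tE] := Ay; exists t => t0; apply: y0.
  by rewrite -tE t0 linear0.
move=> B Blin.
have [H|] := pselect (forall t, B t -> t = 0); first by left.
move=> /existsNP[b /not_implyP[Bb b0]]; right=> t.
have [|||b' Bb' /fI <-//] := Amin (fun z => exists2 t, B t & f t = z) _ _ (f t).
- split; first exact: img_is_submod.
  by exists (f b); split; [exists b | move/(iffLR (injP f) fI)].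
- by move=> z [t' _ <-]; apply/fP; exists t'.
- by apply/fP; exists t.
Qed.

(** Suppose that g : k -> Q is onto and that ker g annihilates the submodule Z of Y.
    Then the length of Z is at most that of Q: if v = g z0 generates a
    simple submodule of Q, multiplication by z0 on Z has a kernel annihilated by
    the kernel of k -> Q / k v, while its image lies in k s, which is simple. *)
Lemma monolith_length_le l (Y : lmodType k) (s : Y) :
  length_le l (k^o : lmodType k) -> monolith s -> length_le l Y.
Proof.
move=> kl [s0 sY].
suff H n (Q : lmodType k) (g : {linear (k^o : lmodType k) -> Q}) :
  surjective g ->
    length_le n Q -> forall (Z : lmodType k) (i :
      {linear Z -> Y}), injective i ->
    (forall z a, g a = 0 -> a *: i z = 0) -> length_le n Z.
  apply: (H l k^o idfun _ kl Y idfun) => //; first by move=> x; exists x.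
  by move=> z a /= ->; rewrite scale0r.
elim: n Q g => [|n IH] Q g gS Qn Z i iI gi.
  apply: length_le_zero => z; apply: (iffLR (injP i) iI).
  by rewrite -[i z]scale1r; apply: gi; exact: length_le0.
have [Q0|Q0] := pselect (zero_module Q).
  apply: (@length_le_le _ 0) => //; apply: length_le_zero => z;
    apply: (iffLR (injP i) iI).
  by rewrite -[i z]scale1r; apply: gi; exact: Q0.
have [T [j [Ts jI]]] := simple_sub (ex_intro (fun n => length_le n Q) _ Qn) Q0.
have [[t0 t00] _] := iffLR (simpleP _) Ts.
have tgen (t1 t : T) : t1 <> 0 -> exists b : k, t = b *: t1 by exact:
  simple_gen.
have [z0 z0E] := gS (j t0).
have gb b : g (b * z0) = j (b *: t0).
  by rewrite -[b * z0]/(b *: (z0 : k^o)) !linearZZ z0E.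
have [Q' [h [_ hS hP]]] := ses_coker jI.
have [m mE] : exists m : {linear Z -> Y}, forall z, m z = z0 *: i z.
  by apply: linear_of => a x y; rewrite linearP scalerDr !scalerA mulrC.
have [Z'' [i'' [iI'' iP'']]] := sub_module_of (im_is_submod m).
have [z|m' mE'] := lift_lin (h := m) iI''; first by apply/iP''; exists z.
have mS : surjective m'.
  move=> w; have [z zE] : exists z, m z = i'' w by apply/iP''; exists w.
  by exists z; apply: iI''; rewrite mE'.
have [Z' [i' S']] := ses_ker mS; have [iI' _ iP'] := S'.
rewrite -addn1; apply: (@length_le_ext _ n 1 Z' Z Z''); first by exists i', m'.
  apply: (IH Q' (h \o g : {linear _ -> _}) _ _ Z' (i \o i' : {linear _ -> _})).
  - by move=> q'; have [q <-] := hS q'; have [a <-] := gS q; exists a.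
  - apply: (length_le_quo_lt (g := h) (x := j t0)) Qn => //; first by apply/hP;
      exists t0.
    by move=> /(iffLR (injP j) jI).
  - exact: inj_comp.
  move=> z' a /= /hP[t tE]; have [b bE] := tgen t0 t t00.
  have z0z : z0 *: i (i' z') = 0.
    by rewrite -mE -mE' (_ : m' (i' z') = 0) ?linear0 //; apply/iP'; exists z'.
  have := gi (i' z') (a - b * z0); rewrite linearB gb -bE tE subrr => /(_
    erefl)/eqP.
  by rewrite scalerBl -scalerA z0z scaler0 subr0 => /eqP.
have wgen (w : Z'') : w <> 0 -> exists b c, s = b *: i'' w /\ i'' w = c *: s.
  move=> w0; have [|b bE] := sY _ (line_is_submod (i'' w)).
    exists (i'' w); split; first by exists 1; rewrite scale1r.
    by move/(iffLR (injP i'') iI'').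
  have [z zE] : exists z, m z = i'' w by apply/iP''; exists w.
  have bt0 : b *: t0 <> 0.
    move=> bt0; apply: s0; rewrite bE -zE mE scalerA; apply: gi.
    by rewrite gb bt0 linear0.
  have [c cE] := tgen _ t0 bt0.
  exists b, c; split=> //.
  rewrite bE -zE mE !scalerA; apply/eqP; rewrite -subr_eq0 -scalerBl;
    apply/eqP/gi.
  by rewrite linearB z0E gb -scalerA -cE subrr.
move=> W f fI fS; apply: length_le_zero => w; apply: contrapT => w0;
  apply: fS => v.
have fw0 : f w <> 0 by move/(iffLR (injP f) fI).
have [v0|v0] := pselect (v = 0); first by exists 0; rewrite linear0.
have [b [_ [bE _]]] := wgen _ fw0; have [_ [c [_ cE]]] := wgen _ v0.
exists (c *: (b *: w)); apply: iI''.
by rewrite 2!(linearZZ f) 2!(linearZZ i'') cE bE.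
Qed.

Variable A : algType k.

(** An alias of M, so that its carrier can bear a second scalar multiplication. *)
Definition restr (M : lmodType A^c) : Type := M.

Section Restr.
Variable M : lmodType A^c.
HB.instance Definition _ := GRing.Zmodule.on (restr M).

Definition restr_scale (c : k) (x : restr M) : restr M :=
  ((c%:A : A) : A^c) *: (x : M).

Fact restr_scaleA a b x : restr_scale a (restr_scale b x) = restr_scale (a * b)
  x.
Proof.
rewrite /restr_scale scalerA; congr (_ *: _).
by rewrite -[LHS]/((b%:A : A) * (a%:A : A)) -scalerAl mul1r scalerA mulrC.
Qed.

Fact restr_scale1 : left_id 1 restr_scale.
Proof. by move=> x; rewrite /restr_scale scale1r; exact: scale1r. Qed.

Fact restr_scaleDr : right_distributive restr_scale +%R.
Proof. by move=> a x y; exact: scalerDr. Qed.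

Fact restr_scaleDl x : {morph restr_scale^~ x : a b / a + b}.
Proof. by move=> a b; rewrite /restr_scale scalerDl; exact: scalerDl. Qed.

HB.instance Definition _ := GRing.Zmodule_isLmodule.Build k (restr M)
  restr_scaleA restr_scale1 restr_scaleDr restr_scaleDl.
End Restr.

Lemma restr_lin (M N : lmodType A^c) (f : {linear M -> N}) :
  exists g : {linear restr M -> restr N}, forall x, g x = f x.
Proof.
by apply: linear_of => a x y; exact: (linearP f ((a%:A : A) : A^c) (x : M) (y :
  M)).
Qed.

Lemma restr_length_le n (M : lmodType A^c) : length_le n (restr M) ->
  length_le n M.
Proof.
elim: n M => [|n IH] M H N f fI fS; have [g gE] := restr_lin f.
all: have gI : injective g by (move=> x y; rewrite !gE => /fI).
all: have gS : ~ surjective g by (move=> gS; apply: fS => y;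
  have [x <-] := gS y; exists x; rewrite gE).
  exact: H gI gS.
by apply: IH; exact: H gI gS.
Qed.

Lemma restr_ses (X Y Z : lmodType A^c) : ses X Y Z ->
  ses (restr X : lmodType k) (restr Y : lmodType k) (restr Z : lmodType k).
Proof.
move=> [f [g [fI gS fg]]]; have [f' fE] := restr_lin f;
  have [g' gE] := restr_lin g.
exists f', g'; split.
- by move=> x y; rewrite !fE => /fI.
- by move=> z; have [y <-] := gS z; exists y; rewrite gE.
by move=> y; rewrite gE; split=> [/fg[x <-]|[x <-]]; [exists x|apply/fg;
  exists x]; rewrite fE.
Qed.

Lemma restr_ring : finite_length (A : lmodType k) ->
  finite_length (restr (A^c)^o : lmodType k).
Proof.
have [g gE] : exists g :
  {linear (A : lmodType k) -> (restr (A^c)^o : lmodType k)},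
    forall x, g x = (x : A).
  apply: linear_of => a x y; congr (_ + _).
  by rewrite -[RHS]/((x : A) * (a%:A : A)) -scalerAr mulr1.
by apply: (finite_length_quo (g := g)) => x; exists (x : A); rewrite gE.
Qed.

Lemma restr_finite_length (M : lmodType A^c) :
  finite_length (A : lmodType k) -> finite_length M ->
    finite_length (restr M : lmodType k).
Proof.
move=> /restr_ring Af /finite_length_fgen/fgen_cover[n [g gS]].
have [h hE] := restr_lin g; apply: (@finite_length_quo _ _ _ h).
  by move=> x; have [y <-] := gS x; exists y; rewrite hE.
elim: n {g gS h hE} => [|n IH].
  by apply: finite_length_zero => x; exact: power0.
by apply: finite_length_ext (restr_ses (ses_prod_proj _ _)) Af IH.
Qed.

(** Let e_1, ..., e_r generate A over k and let g : X -> Q be a k-linear quotient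
    which is monolithic at s.  The k-linear map X -> Q^r with components
    v |-> g (e_i v) is injective: a nonzero v in its kernel would generate an
    A-submodule inside ker g, although that submodule contains s.  Hence the
    length of X is at most r times that of k. *)
Lemma artin_algebra_bounds : artin_algebra A ->
  finite_length ((A^c)^o : lmodType A^c) /\
  exists B, forall (X : lmodType A^c) (s : X), finite_length X -> monolith s ->
    length_le B X.
Proof.
move=> [/artinian_finite_length kf Afg].
have Af : finite_length (A : lmodType k) := fgen_finite_length kf Afg.
split; first by have [n H] := restr_ring Af; exists n; exact: restr_length_le.
have [r [e eP]] := Afg; have [l kl] := kf.
exists (r * l)%N => X s Xf [s0 sX]; apply: restr_length_le.
have [Q [g [gS gm]]] := @monolith_quo _ _ (s :
  restr X) (restr_finite_length Af Xf) s0.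
have /choice[u uE] (i : 'I_r) : exists f : {linear restr X -> Q},
    forall v, f v = g (((e i : A) : A^c) *: (v : X)).
  apply: linear_of => a x y; rewrite -linearP; congr (g _).
  rewrite -[RHS]/(((a%:A : A) : A^c) *: (((e i : A) : A^c) *: (x : X))
                  + ((e i : A) : A^c) *: (y : X)).
  rewrite -[a *: x + y]/(((a%:A : A) : A^c) *: (x : X) + (y : X)).
  rewrite scalerDr !scalerA; congr (_ + _); apply: (congr1 (fun z : A^c => z *:
    (x : X))).
  rewrite -[LHS]/((a%:A : A) * (e i : A)) -[RHS]/((e i : A) * (a%:A : A)).
  by rewrite -scalerAl mul1r -scalerAr mulr1.
have [F FP] := power_map u.
apply: (length_le_sub (g := F)) (length_le_power r (monolith_length_le kl gm)).
apply/injP => v Fv; apply: contrapT => v0.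
have [|a aE] := sX _ (@line_is_submod _ X v).
  by exists v; split=> //; exists 1; rewrite scale1r.
case: gm => gs _; apply: gs; rewrite aE.
have [c cE] := eP (a : A).
have [L LE] : exists L : {linear (A : lmodType k) -> (restr X : lmodType k)},
    forall b, L b = ((b : A) : A^c) *: (v : X).
  apply: linear_of => b x y.
  rewrite -[RHS]/(((b%:A : A) : A^c) *: (((x : A) : A^c) *: (v : X))
                  + ((y : A) : A^c) *: (v : X)).
  rewrite scalerA -scalerDl; apply: (congr1 (fun z : A^c => z *: (v : X)));
    congr (_ + _).
  by rewrite -[RHS]/((x : A) * (b%:A : A)) -scalerAr mulr1.
rewrite -[a *: (v : X)](LE a) cE !linear_sum big1 // => i _.
by rewrite !linearZZ LE -uE FP // scaler0.
Qed.
End Artinian.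

(** * Radical and top *)

Section Radical.
Variable R : pzRingType.
Implicit Types C K L M N P Q T U V W X Y Z : lmodType R.

Local Notation rad M := (@Defs.rad R M).

Lemma sub_moduleP M (N : submodClosed M) x : x \in N ->
  exists y : sub_module N, val y = x.
Proof. by move=> xN; exists (exist _ x xN). Qed.

Lemma radP M (x : M) : x \in rad M <->
  forall T (f : {linear M -> T}), simple_module T -> f x = 0.
Proof.
split=> [/asboolP xR T f Ts|H].
  apply: contrapT => fx.
  have [N NP] := submod_of (ker_is_submod f).
  apply: fx; apply/NP; apply: contrapT => xN; case: (xN); apply: xR; split.
    by exists x; exact/negP.
  move=> N' NN'; have [_ H] := iffLR (simpleP _) Ts.
  have [H0|HT] := H _ (img_is_submod f (mem_is_submod N')).
    left=> y; apply/idP/idP => [yN'|/NN'//].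
    by apply/NP; apply: H0; exists y.
  right=> y; have [y' yN' E] := HT (f y).
  rewrite -(subrK y' y) rpredD // NN' //; apply/NP.
  by rewrite linearB E subrr.
apply/asboolP => N [[y yN] Nmax]; have [g [gS gP]] := quo_lin N.
apply/gP; apply: H; apply/simpleP; split.
  by exists (g y); move/gP; apply/negP.
move=> A Alin; have [N' NP'] := submod_of (preim_is_submod g Alin).
have [|NN|NT] := Nmax N'.
- by move=> z /gP zN; apply/NP'; rewrite zN; case: Alin.
- left=> q; have [z <-] := gS q => Agz; apply/gP.
  by rewrite -NN; apply/NP'.
by right=> q; have [z <-] := gS q; apply/NP'; exact: NT.
Qed.

Lemma rad_map M N (f : {linear M -> N}) x : x \in rad M -> f x \in rad N.
Proof.
move=> /radP xR; apply/radP => T g Ts; exact: (xR T (g \o f :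
  {linear _ -> _}) Ts).
Qed.

(** If C is minimal among the submodules that f maps onto N, then the kernel of
    f on C lies in the kernel of every map from M to a simple module; on C such
    maps therefore factor through N. *)
Lemma rad_surj M N (f : {linear M -> N}) y : finite_length M -> surjective f ->
  y \in rad N -> exists2 x, x \in rad M & f x = y.
Proof.
move=> Mf fS /radP yR.
pose P (A : M -> Prop) := is_submod A /\ forall n, exists a, A a /\ f a = n.
have [||A [Alin AS] Amin] := @sub_min _ M P Mf.
- by move=> ? [].
- by exists (fun=> True); split=> // n; have [x] := fS n; exists x.
have [C [i [iI iP]]] := sub_module_of Alin.
have fiS : surjective (f \o i : {linear _ -> _}).
  by move=> n; have [a [/iP[c <-] <-]] := AS n; exists c.
have [c cE] := fiS y; exists (i c) => //; apply/radP => T h Ts.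
have [H|] := pselect (forall c, f (i c) = 0 -> h (i c) = 0).
  have [w wE] := factor_lin (h := h \o i : {linear _ -> _}) fiS H.
  by have /= <- := wE c; rewrite -[f (i c)]/((f \o i) c) cE; exact: yR.
move=> /existsNP[c0 /not_implyP[fc0 hc0]]; case: (hc0).
have [|||_ //] := Amin (fun a => A a /\ h a = 0) _ _ (i c0).
- split; first by apply: cap_is_submod => //; exact: ker_is_submod.
  move=> n; have [a [Aa <-]] := AS n.
  have [b bE] := simple_gen (h a) Ts hc0.
  exists (a - b *: i c0); split; last by rewrite linearB linearZZ fc0 scaler0
    subr0.
  split; last by rewrite linearB linearZZ bE subrr.
  apply: (is_submodB Alin) => //; apply: (is_submodZ _ Alin); apply/iP;
    by exists c0.
- by move=> a [].
by apply/iP; exists c0.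
Qed.

Lemma direct_sum0 (X : 'I_0 -> lmodType R) : zero_module (direct_sum X).
Proof. rewrite /direct_sum big_ord0; exact: (@power0 _ 'rV[R]_0). Qed.

Lemma direct_sumS n (X : 'I_n.+1 -> lmodType R) :
  direct_sum X = (X ord0 * direct_sum (fun i => X (lift ord0 i)))%type.
Proof. by rewrite /direct_sum big_ord_recl. Qed.

Lemma direct_sum_sep n (X : 'I_n -> lmodType R) (y : direct_sum X) : y <> 0 ->
  exists i (p : {linear direct_sum X -> X i}), p y <> 0.
Proof.
elim: n X y => [|n IH] X; first by move=> y []; exact: direct_sum0.
rewrite direct_sumS => -[y1 y2] y0.
have [y10|y10] := pselect (y1 = 0); last by exists ord0, fst.
have [|i [p py]] := IH _ y2; first by move=> y20; apply: y0; rewrite y10 y20.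
by exists (lift ord0 i), (p \o snd : {linear _ -> _}).
Qed.

Lemma direct_sum_cosep n (X : 'I_n -> lmodType R) V (f :
  {linear direct_sum X -> V}) :
  (exists y, f y <> 0) -> exists i (g : {linear X i -> V}), exists x, g x <> 0.
Proof.
elim: n X f => [|n IH] X.
  by move=> f [y []]; rewrite (direct_sum0 y) linear0.
rewrite direct_sumS => f [[y1 y2] fy].
set Y := direct_sum _ in f y2 fy *.
have [a aE] := pair_lin (idfun : {linear X ord0 -> X ord0}) (\0 :
  {linear X ord0 -> Y}).
have [b bE] := pair_lin (\0 : {linear Y -> X ord0}) (idfun : {linear Y -> Y}).
have [fa|fa] := pselect (f (a y1) = 0); last first.
  by exists ord0, (f \o a : {linear _ -> _}), y1.
have [|i [g [x gx]]] := IH _ (f \o b : {linear _ -> _}).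
  exists y2; rewrite /= => fb; apply: fy.
  have -> : (y1, y2) = a y1 + b y2.
    by rewrite aE bE; congr (_, _); rewrite /= ?addr0 ?add0r.
  by rewrite linearD fa fb addr0.
by exists (lift ord0 i), g, x.
Qed.

Lemma top_lin M : exists g : {linear M -> top M},
  surjective g /\ forall x, g x = 0 <-> x \in rad M.
Proof. exact: quo_lin. Qed.

(** Take a map f from M onto a finite direct sum of simples with minimal kernel.  A
    map h from M to a simple module that does not vanish on ker f could be
    added as a further component, so ker f is contained in the radical. *)
Lemma top_semisimple M : finite_length M -> exists n (X : 'I_n -> lmodType R),
  (forall i, simple_module (X i) /\ exists f :
    {linear M -> X i}, exists x, f x <> 0)
  /\ isomorphic (top M) (direct_sum X).
Proof.
move=> Mf; pose P (A : M -> Prop) := exists n (X : 'I_n -> lmodType R)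
  (f : {linear M -> direct_sum X}), [/\ surjective f,
    forall i, simple_module (X i) /\ exists f :
      {linear M -> X i}, exists x, f x <> 0
  & forall x, A x <-> f x = 0].
have [|||A [n [X [f [fS Xs fP]]]] Amin] := @sub_min _ M P.
- exact: Mf.
- move=> A [n [X [f [_ _ fP]]]]; have [k0 kD] := ker_is_submod f.
  by split=> [|a x y]; rewrite !fP //; exact: kD.
- exists (fun=> True), 0, (fun=> M), \0; split=> // [y|[]//].
  by exists 0; rewrite [y]direct_sum0.
exists n, X; split=> //.
have fker x : f x = 0 <-> x \in rad M.
  split=> [fx|/radP xR]; last first.
    apply: contrapT => /direct_sum_sep[i [p px]]; apply: px.
    exact: (xR _ (p \o f : {linear _ -> _}) (Xs i).1).
  apply/radP => T h Ts; apply: contrapT => hx.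
  (* Add h as a component; E turns the product into a direct sum over n + 1. *)
  have [z Pz] : exists F : {linear M -> (T * direct_sum X)%type},
    forall x, F x = (h x, f x) by exact: pair_lin.
  pose X' (i : 'I_n.+1) := if unlift ord0 i is Some j then X j else T.
  have E : direct_sum X' = (T * direct_sum X)%type.
    rewrite direct_sumS /X' unlift_none; congr (_ * direct_sum _)%type.
    by apply: funext => i; rewrite liftK.
  have PB : P (fun x => z x = 0).
    exists n.+1, X'; rewrite E; exists z; split=> //.
      move=> [t s]; have [m mE] := fS s.
      have [b bE] := simple_gen (t - h m) Ts hx.
      exists (m + b *: x); rewrite Pz !linearD !linearZZ fx -bE mE.
      by congr (_, _); rewrite /= ?scaler0 ?addr0 // addrC subrK.
    move=> i; rewrite /X'; case: (unlift ord0 i) => [j|]; first exact: Xs.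
    by split=> //; exists h, x.
  apply: hx; suff : z x = 0 by rewrite Pz => -[].
  apply: (Amin _ PB) => [y|]; last exact/fP.
  by rewrite Pz => -[_ /fP].
have [g [gS gP]] := top_lin M.
have [x /gP/fker//|u uE] := factor_lin (h := f) gS.
apply: (@inj_surj_iso _ _ _ u).
  by apply/injP => q; have [x <-] := gS q; rewrite uE => /fker/gP.
by move=> y; have [x <-] := fS y; exists (g x); rewrite uE.
Qed.

End Radical.

(** * Torsion and layers *)

Section Torsion.
Variable R : pzRingType.
Hypothesis RF : finite_length (R^o : lmodType R).
Variable S : lmodType R -> Prop.
Implicit Types C K L M N P Q T U V W X Y Z : lmodType R.

Local Notation rad M := (@Defs.rad R M).
Local Notation torsion S M := (@Defs.torsion R S M).

Lemma simple_notin_iso T T' : isomorphic T T' -> simple_notin S T ->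
  simple_notin S T'.
Proof.
move=> TT' [Ts TS]; split; first exact: simple_iso TT' Ts.
by move=> [N [SN NT]]; apply: TS; exists N; split=> //; exact: iso_trans TT' NT.
Qed.

Lemma simple_map_iso T T' (f : {linear T -> T'}) :
  simple_module T -> simple_module T' -> (exists x, f x <> 0) ->
    isomorphic T T'.
Proof.
move=> Ts Ts' fx; apply: (@inj_surj_iso _ _ _ f); first exact: simple_inj.
exact: simple_surj.
Qed.

Lemma torsion_map M N (f : {linear M -> N}) x :
  x \in torsion S M -> f x \in torsion S N.
Proof.
move=> /asboolP[n [x_ [-> H]]]; apply/asboolP.
exists n, (fun i => f (x_ i)); split; first by rewrite linear_sum.
move=> i; have [T [g [TT [t <-]]]] := H i.
by exists T, (f \o g : {linear _ -> _}); split=> //; exists t.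
Qed.

Lemma torsion_class_im T M (f : {linear T -> M}) t :
  torsion_class S T -> f t \in torsion S M.
Proof.
move=> TT; apply/asboolP; exists 1%N, (fun=> f t); split;
  first by rewrite big_ord1.
by move=> _; exists T, f; split=> //; exists t.
Qed.

(** In a minimal submodule N of Y on which u does not vanish, the kernel of u is
    the only maximal submodule, so all simple quotients of N are isomorphic to V
    and N is in the torsion class. *)
Lemma torsion_detect Y V (u : {linear Y -> V}) : finite_length Y ->
  simple_notin S V ->
  (exists y, u y <> 0) -> exists2 y, y \in torsion S Y & u y <> 0.
Proof.
move=> Yf Vb [y0 uy0].
pose P (A : Y -> Prop) := is_submod A /\ exists a, A a /\ u a <> 0.
have [||A [Alin [a [Aa ua]]] Amin] := @sub_min _ Y P Yf.
- by move=> ? [].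
- by exists (fun=> True); split=> //; exists y0.
have [N [i [iI iP]]] := sub_module_of Alin; have [c cE] :
  exists c, i c = a by apply/iP.
have Nf := finite_length_sub iI Yf.
exists a => //; rewrite -cE; apply: torsion_class_im; split;
  first exact: finite_length_fgen.
have [n [X [Xs topX]]] := top_semisimple Nf.
have topN : fgen (top N).
  by have [g [gS _]] := top_lin N; apply/finite_length_fgen/(finite_length_quo
    gS).
have [Z Z0] := zero_module_ex R; split=> //; exists n, X, Z; split; last first.
  apply: iso_trans topX; apply: iso_sym; apply: ses_zero_r Z0 _.
  exact: ses_prod_proj.
move=> j; have [Xj [h [d hd]]] := Xs j.
have [H|] := pselect (forall e, h e = 0 -> u (i e) = 0); last first.
  move=> /existsNP[e /not_implyP[he uie]]; case: hd.
  have [|||d' hd' /iI<-//] := Amin (fun y => exists2 e,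
    h e = 0 & i e = y) _ _ (i d).
  - split; first by apply: img_is_submod; exact: ker_is_submod.
    by exists (i e); split=> //; exists e.
  - by move=> y [e' _ <-]; apply/iP; exists e'.
  by apply/iP; exists d.
have hS : surjective h by apply: simple_surj => //; exists d.
have [w wE] := factor_lin (h := u \o i : {linear _ -> _}) hS H.
apply: (simple_notin_iso _ Vb); apply: iso_sym;
  apply: (@simple_map_iso _ _ w) => //.
  by case: Vb.
by exists (h c); rewrite wE /= cE.
Qed.

Lemma torsion_class_quo T V (h : {linear T -> V}) :
  torsion_class S T -> simple_module V -> (exists t, h t <> 0) ->
    simple_notin S V.
Proof.
move=> [_ [_ [n [X [M' [Xb /isoE[a [b [aK bK]]]]]]]]] Vs [t ht].
have [g [gS gP]] := top_lin T.
have [x /gP/radP H|w wE] := factor_lin (h := h) gS; first exact: H.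
have [|i [q [x qx]]] := @direct_sum_cosep _ n X V (w \o (fst \o b) :
  {linear _ -> _}).
  by exists (a (g t, 0)); rewrite /= aK /= wE.
by apply: simple_notin_iso (Xb i); apply: (@simple_map_iso _ _ q) => //;
  [case: (Xb i) | exists x].
Qed.

(** The failure for a map h : T -> N from the torsion class would give a simple
    quotient V of T that is not in S and on which t(M) vanishes.  But V is
    also a quotient of the fibre product of M and T over N, whose torsion
    elements are nonzero in V somewhere by [torsion_detect], and their
    first components lie in t(M). *)
Lemma torsion_surj M N (f : {linear M -> N}) y : finite_length M ->
  surjective f ->
  y \in torsion S N -> exists2 x, x \in torsion S M & f x = y.
Proof.
move=> Mf fS /asboolP[n [y_ [-> H]]].
suff /choice[x_ xP] i : exists x, x \in torsion S M /\ f x = y_ i.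
  exists (\sum_i x_ i); first by apply: rpred_sum => i _; exact: (xP i).1.
  by rewrite linear_sum; apply: eq_bigr => i _; exact: (xP i).2.
have [T [h [TT [t <-]]]] := H i.
pose A t := exists2 x, x \in torsion S M & f x = h t.
have Alin : is_submod A := preim_is_submod h (img_is_submod f (mem_is_submod
  (torsion S M))).
have [[x xt xE]|At] := pselect (A t); first by exists x.
have Tf : finite_length T by apply: fgen_finite_length => //; case: TT.
have [Q [g [gS gP]]] := quotient_of Alin.
have [||V [v [Vs vS]]] := @simple_quo _ Q; first exact: finite_length_quo gS Tf.
  by move=> Q0; apply/At/gP; exact: Q0.
have [[v0 v00] _] := iffLR (simpleP _) Vs.
have [q qE] := vS v0; have [t0 t0E] := gS q.
have Vb : simple_notin S V.
  apply: (torsion_class_quo (h := v \o g : {linear _ -> _}) TT Vs).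
  by exists t0; rewrite /= t0E qE.
have [D DE] := copair_lin f (\- h : {linear _ -> _}).
have [Y [i' [iI iP]]] := sub_module_of (ker_is_submod D).
have [||z zt zE] := @torsion_detect Y V (v \o (g \o (snd \o i')) :
  {linear _ -> _}) _ Vb.
- by apply: finite_length_sub iI _; exact: finite_length_prod.
- have [m mE] := fS (h t0).
  have /iP[z zE] : D (m, t0) = 0 by rewrite DE /= mE subrr.
  by exists z; rewrite /= zE /= t0E qE.
case: zE; rewrite /=.
have -> : g (i' z).2 = 0; last by rewrite linear0.
apply/gP; exists (i' z).1; first exact: (torsion_map (fst \o i' :
  {linear _ -> _})).
have /iP : exists c, i' c = i' z by exists z.
by rewrite DE => /eqP; rewrite /= subr_eq0 => /eqP.
Qed.

Definition incl M : {linear rad_torsion S M -> M} :=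
  (val : {linear sub_module (torsion S M) -> M}) \o
  (val : {linear rad_torsion S M -> sub_module (torsion S M)}).

Lemma incl_inj M : injective (incl M).
Proof. by move=> x y /val_inj/val_inj. Qed.

Lemma torsion_restr M N (f : {linear M -> N}) :
  exists f' : {linear sub_module (torsion S M) -> sub_module (torsion S N)},
    (forall z, val (f' z) = f (val z)) /\ (finite_length M -> surjective f ->
      surjective f').
Proof.
have [x|u uE] := lift_lin (Y := sub_module (torsion S N))
  (f := (val : {linear _ -> N})) (h := f \o val :
    {linear sub_module (torsion S M) -> N}) val_inj.
  by apply: sub_moduleP; apply: (torsion_map f); exact: (valP x).
exists u; split=> [//|Mf fS y].
have [x xt xE] := torsion_surj Mf fS (valP y).
by have [z zE] := sub_moduleP xt; exists z; apply: val_inj; rewrite uE /= zE.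
Qed.

Lemma rad_restr M N (f : {linear M -> N}) :
  exists f' : {linear sub_module (rad M) -> sub_module (rad N)},
    (forall z, val (f' z) = f (val z)) /\ (finite_length M -> surjective f ->
      surjective f').
Proof.
have [x|u uE] := lift_lin (Y := sub_module (rad N))
  (f := (val : {linear _ -> N})) (h := f \o val :
    {linear sub_module (rad M) -> N}) val_inj.
  by apply: sub_moduleP; apply: (rad_map f); exact: (valP x).
exists u; split=> [//|Mf fS y].
have [x xt xE] := rad_surj Mf fS (valP y).
by have [z zE] := sub_moduleP xt; exists z; apply: val_inj; rewrite uE /= zE.
Qed.

Lemma rad_torsion_restr M N (f : {linear M -> N}) :
  exists f' : {linear rad_torsion S M -> rad_torsion S N},
    (forall z, incl N (f' z) = f (incl M z)) /\ (finite_length M ->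
      surjective f -> surjective f').
Proof.
have [g [gE gS]] := torsion_restr f; have [h [hE hS]] := rad_restr g.
exists h; split=> [z|Mf fS]; first by rewrite /= hE gE.
by apply: hS (gS Mf fS); apply: finite_length_sub Mf; exact: val_inj.
Qed.

Lemma rad_torsion_finite_length M : finite_length M ->
  finite_length (rad_torsion S M).
Proof. exact: finite_length_sub (@incl_inj M). Qed.

(** The layer length of M is at most n: vanishing of the torsion persists once
    it is reached. *)
Definition layers_le n M := zero_module (sub_module (torsion S (iter n
  (rad_torsion S) M))).

Lemma layers_le0 M : layers_le 0 M <-> forall x, x \in torsion S M -> x = 0.
Proof.
split=> [H x xt|H x]; first by have [z <-] := sub_moduleP xt; rewrite [z]H.
by apply: val_inj; rewrite (H _ (valP x)).
Qed.

Lemma layers_leS n M : layers_le n.+1 M = layers_le n (rad_torsion S M).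
Proof. by rewrite /layers_le iterSr. Qed.

Lemma layers_le_surj n M N (f : {linear M -> N}) :
  finite_length M -> surjective f -> layers_le n M -> layers_le n N.
Proof.
elim: n M N f => [|n IH] M N f Mf fS.
  rewrite !layers_le0 => H y yt; have [x xt <-] := torsion_surj Mf fS yt.
  by rewrite (H x xt) linear0.
rewrite !layers_leS; have [g [_ gS]] := rad_torsion_restr f.
exact: IH (rad_torsion_finite_length Mf) (gS Mf fS).
Qed.

Lemma layers_le_sub n X Y W (f : {linear W -> X}) (g : {linear W -> Y}) :
  (forall w, f w = 0 -> g w = 0 -> w = 0) ->
  layers_le n X -> layers_le n Y -> layers_le n W.
Proof.
elim: n X Y W f g => [|n IH] X Y W f g fg.
  rewrite !layers_le0 => HX HY w wt; apply: fg.
    by apply: HX; exact: torsion_map.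
  by apply: HY; exact: torsion_map.
rewrite !layers_leS; have [f' [fE _]] := rad_torsion_restr f.
have [g' [gE _]] := rad_torsion_restr g.
apply: (IH _ _ _ f' g') => w fw gw; apply: (iffLR (injP _) (@incl_inj W)).
by apply: fg; rewrite -?fE -?gE ?fw ?gw linear0.
Qed.

(** Free modules inherit the bound through their projections, since rad t
    preserves jointly injective maps; quotients inherit it since rad t
    preserves surjections. *)
Lemma layers_le_all n M : layers_le n (R^o : lmodType R) -> finite_length M ->
  layers_le n M.
Proof.
move=> H /finite_length_fgen/fgen_cover[m [g gS]].
apply: layers_le_surj gS _; first exact: finite_length_power.
elim: m {g} => [|m IH].
  by apply: (layers_le_sub (f := \0) (g := \0) _ H H) => w _ _; exact: power0.
  by apply: (layers_le_sub (f := fst) (g := snd) _ H IH) => -[a b] /= -> ->.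
Qed.

(** * Syzygies of modules of finite layer length *)

Variable p : nat.
(** Projective dimension at most p - 1; for p = 0 only the zero module. *)
Definition pd_lt M := exists2 Z, zero_module Z & nth_syzygy p M Z.
Hypothesis Sp : forall N, S N -> pd_lt N.

Lemma pd_lt_ext X Y Z : ses X Y Z -> pd_lt X -> pd_lt Z -> pd_lt Y.
Proof.
move=> E [KX KX0 XK] [KZ KZ0 ZK].
have [KY YK EK] := nth_syzygy_horseshoe E XK ZK; exists KY => //.
have /isoE[f [g [_ gK]]] := ses_zero_r KZ0 EK.
by move=> y; rewrite -[y]gK (KX0 (g y)) linear0.
Qed.

Lemma pd_lt_zero X : zero_module X -> pd_lt X.
Proof. by move=> X0; exists X => //; exact: nth_syzygy_zero. Qed.

Lemma pd_lt_iso X Y : isomorphic X Y -> pd_lt X -> pd_lt Y.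
Proof.
move=> XY Xp; have [Z Z0] := zero_module_ex R.
exact: pd_lt_ext (ses_iso XY Z0) Xp (pd_lt_zero Z0).
Qed.

(** By [torsion_detect] every simple quotient of a torsion-free module is in S, and
    the kernel of the quotient map is torsion-free again. *)
Lemma pd_lt_torsionfree X : finite_length X -> (forall x, x \in torsion S X ->
  x = 0) -> pd_lt X.
Proof.
move=> Xf; have [n] := Xf; elim: n X Xf => [|n IH] X Xf Xn Xt.
  by apply: pd_lt_zero; exact: length_le0.
have [X0|X0] := pselect (zero_module X); first exact: pd_lt_zero.
have [V [g [Vs gS]]] := simple_quo Xf X0.
have [[v v0] _] := iffLR (simpleP _) Vs.
have [N [i E]] := ses_ker gS; have [iI _ iP] := E.
apply: (@pd_lt_ext N X V); first by exists i, g.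
  apply: IH; first exact: finite_length_sub iI Xf.
    apply: Xn iI _ => iS; apply: v0; have [x <-] := gS v; apply/iP; exact: iS.
  by move=> x xt; apply: (iffLR (injP i) iI); apply: Xt; exact: torsion_map.
have [Vb|Vb] := pselect (simple_notin S V).
  have [|y /Xt -> []] := torsion_detect (u := g) Xf Vb; last by rewrite linear0.
  by have [x gx] := gS v; exists x; rewrite gx.
have [N' [SN VN]] : exists N, S N /\ isomorphic V N.
  by apply: contrapT => H; apply: Vb.
by apply: pd_lt_iso (iso_sym VN) _; exact: Sp.
Qed.

Lemma semisimple_nth_syzygy K0 : (forall T, simple_module T ->
  exists2 K, nth_syzygy p T K & add_of K0 K) ->
  forall n (X : 'I_n -> lmodType R), (forall i, simple_module (X i)) ->
  exists2 K, nth_syzygy p (direct_sum X) K & add_of K0 K.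
Proof.
move=> H; elim=> [|n IH] X Xs.
  have [Z Z0] := zero_module_ex R; exists Z; last exact: add_of_zero.
  by apply: nth_syzygy_zero => //; exact: direct_sum0.
have [K XK KK] := H _ (Xs ord0); have [L YL LK] :=
  IH _ (fun i => Xs (lift ord0 i)).
exists (K * L)%type; last exact: add_of_prod.
by rewrite direct_sumS; exact: nth_syzygy_prod.
Qed.

Lemma nth_syzygy_iso M M' K : isomorphic M M' -> nth_syzygy p M K ->
  exists2 K', nth_syzygy p M' K' & isomorphic K K'.
Proof.
move=> MM' MK; have [Z Z0] := zero_module_ex R.
have [K' MK' E] := nth_syzygy_horseshoe (ses_iso MM' Z0) MK (nth_syzygy_zero p
  Z0 Z0).
by exists K' => //; exact: ses_zero_r Z0 E.
Qed.

(** With t the torsion of M: M / t has zero p-th syzygy, so M and t share theirs;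
    t is an extension of its top by rad t, and one step pays for the top. *)
Lemma nth_syzygy_built K0 : (forall T, simple_module T ->
  exists2 K, nth_syzygy p T K & add_of K0 K) ->
  forall n M, finite_length M -> layers_le n M ->
    exists2 K, nth_syzygy p M K & built K0 n K.
Proof.
move=> HK; elim=> [|n IH] M Mf; first by move=> /layers_le0/(pd_lt_torsionfree
  Mf)[Z Z0 MZ]; exists Z.
rewrite layers_leS => /(IH _ (rad_torsion_finite_length Mf))[K1 FK1 K1b].
pose t := sub_module (torsion S M) : lmodType R.
have valI : injective (val : {linear t -> M}) by exact: val_inj.
have tf : finite_length t := finite_length_sub valI Mf.
have [m [X [Xs topX]]] := top_semisimple tf.
have [K2' XK2 K2b'] := semisimple_nth_syzygy HK (fun i => (Xs i).1).
have [K2 topK2 KK2] := nth_syzygy_iso (iso_sym topX) XK2.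
have [g [gS gP]] := top_lin t.
have E1 : ses (rad_torsion S M) t (top t).
  exists (val : {linear rad_torsion S M -> t}), g; split=> //;
    first exact: val_inj.
  move=> y; rewrite gP; split=> [yr|[x <-]]; last exact: (valP x).
  exact: sub_moduleP.
have [K3 tK3 E2] := nth_syzygy_horseshoe E1 FK1 topK2.
have [q [qS qP]] := quo_lin (torsion S M).
have E3 : ses t M (quo_module (torsion S M)).
  exists (val : {linear t -> M}), q; split=> // y; rewrite qP.
  split=> [yt|[x <-]]; last exact: (valP x).
  exact: sub_moduleP.
have [|Z Z0 QZ] := @pd_lt_torsionfree (quo_module (torsion S M))
  (finite_length_quo qS Mf).
  by move=> y yt; have [x xt <-] := torsion_surj Mf qS yt; apply/qP.
have [K MK E4] := nth_syzygy_horseshoe E3 tK3 QZ; exists K => //.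
apply: built_retract (retract_iso (iso_sym (ses_zero_r Z0 E4))) _.
rewrite -addn1; apply: built_ext E2 K1b _ => /=.
exists K2, K2, Z; split=> //; [exact: retract_refl| |].
  by apply: add_of_retract K2b'; apply: retract_iso; exact: iso_sym.
by apply: ses_iso Z0; exact: iso_refl.
Qed.

End Torsion.

(** * Extension dimension and projective dimension *)

Section Tower.
Variable R : pzRingType.
Implicit Types C K L M N P Q T U V W X Y Z : lmodType R.

Lemma retract_split U Y : retract U Y -> exists W, isomorphic (U * W)%type Y.
Proof.
move=> [i [r ir]]; have [W [j [jI jP]]] := sub_module_of (ker_is_submod r).
have [f fE] := copair_lin i j; exists W; apply: (@inj_surj_iso _ _ _ f).
  apply/injP => -[u w]; rewrite fE /= => E.
  have jw : r (j w) = 0 by apply/jP; exists w.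
  have u0 : u = 0 by move: (congr1 r E); rewrite linearD ir jw addr0 linear0.
  move: E; rewrite u0 linear0 add0r => /(iffLR (injP j) jI) ->; by [].
move=> y; have /jP[w wE] : r (y - i (r y)) = 0 by rewrite linearB ir subrr.
by exists (r y, w); rewrite fE /= wE addrC subrK.
Qed.

Lemma direct_sum_power T n : direct_sum (fun _ : 'I_n => T) = power T n.
Proof.
by elim: n => [|n IH]; [rewrite /direct_sum big_ord0 | rewrite direct_sumS IH].
Qed.

Lemma add_of_in_add T U : finite_length T -> add_of T U ->
  in_add (fun M => M = T) U.
Proof.
move=> Tf TU; split; first exact/finite_length_fgen/(finite_length_add_of Tf
  TU).
have [n /retract_split[W WU]] := TU; exists n, (fun=> T), W; split=> //.
by rewrite direct_sum_power.
Qed.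

Lemma built_tower T n M : finite_length T -> built T n.+1 M -> tower T n.+1 M.
Proof.
move=> Tf; elim: n M => [|n IH] M.
  move=> [Y [U [V [MY TU V0 E]]]]; apply: add_of_in_add => //.
  apply: add_of_retract TU; apply: retract_trans MY _.
  by apply/retract_iso/iso_sym; exact: ses_zero_r V0 E.
move=> Mb; have Mf := finite_length_fgen (built_finite_length Tf Mb).
case: Mb => Y [U [V [/retract_split[W MW] TU Vb E]]].
have {}Vb : built T n.+1 V := Vb.
have [Z Z0] := zero_module_ex R.
split=> //; exists 1%N, (fun=> Y), W; split.
  have Yf := finite_length_ext E (finite_length_add_of Tf TU)
    (built_finite_length Tf Vb).
  move=> _; split; first exact: finite_length_fgen.
  have [f [g S]] := E; exists U, V, f, g; split=> //;
    first exact: add_of_in_add.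
  exact: IH.
rewrite direct_sum_power; apply: iso_trans MW _.
apply: ses_zero_r (@power0 _ Y) _; exact: ses_prod_proj.
Qed.

(** The kernel of P 0 -> M has a resolution that is one term shorter. *)
Lemma resolution_pd_lt M n : finite_length (R^o : lmodType R) ->
  has_proj_resolution M n -> pd_lt n.+1 M.
Proof.
move=> RF; elim: n M => [|n IH] M [P [d [e [Pp eS ed dd P0]]]].
  have [Z Z0] := zero_module_ex R; exists Z => //; exists Z;
    last exact: iso_refl.
  have [Pfg Ppr] := Pp 0%N; exists (P 0%N); first by split=> //;
    exact: fgen_finite_length.
  exists \0, e; split=> //; first by move=> x y _; rewrite [x]Z0 [y]Z0.
  move=> x; rewrite ed; split=> -[y <-]; last by exists 0; rewrite linear0.
  by exists 0; rewrite [y]P0 // !linear0.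
have [K [i S]] := ses_ker eS; have [iI _ iP] := S.
have [x|e' eE] := lift_lin (h := d 0%N) iI.
  by apply/iP; apply/ed; exists x.
have [|Z Z0 KZ] := IH K.
  exists (fun i => P i.+1), (fun i => d i.+1), e'; split=> //.
  - move=> y; have /ed[x xE] : e (i y) = 0 by apply/iP; exists y.
    by exists x; apply: iI; rewrite eE.
  - move=> x; rewrite -dd -eE; split=> [->|]; first by rewrite linear0.
    by move/(iffLR (injP i) iI).
  - by move=> j nj; apply: P0.
exists Z => //; exists K => //; exists (P 0%N); last by exists i, e.
by have [Pfg Ppr] := Pp 0%N; split=> //; exact: fgen_finite_length.
Qed.

End Tower.

Lemma nat_infP (A : set nat) :
  (forall n, ~ A n) /\ nat_inf A = +oo%E \/
  exists n, [/\ A n, nat_inf A = (n%:Z)%:E & forall m, A m -> (n <= m)%N].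
Proof.
have [[n0 An0]|A0] := pselect (exists n, A n); [right|left].
  have exA : exists n, `[<A n>] by exists n0; apply/asboolP.
  case: (ex_minnP exA) => n /asboolP An nmin; exists n; split=> //; last first.
    by move=> m Am; apply: nmin; apply/asboolP.
  rewrite /nat_inf /infimum ifF; last first.
    by apply/negP => /eqP/seteqP[/(_ (n%:Z)%:E) H _]; apply: H; exists n.
  apply: xget_subset1; last exact: is_subset1_infimums.
  split=> [_ [m Am <-]|y yl]; last by apply: yl; exists n.
  by rewrite lee_fin lez_nat nmin //; apply/asboolP.
split=> [n An|]; first by apply: A0; exists n.
rewrite /nat_inf /infimum ifT //; apply/eqP/seteqP; split=> // v [n An _].
by apply: A0; exists n.
Qed.

Lemma supremum_eq (x0 v : \bar int) (A : set (\bar int)) :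
  (exists x, A x) -> supremums A v -> supremum x0 A = v.
Proof.
move=> [x Ax] vA; rewrite /supremum ifF; last first.
  by apply/negP => /eqP A0; rewrite A0 in Ax.
by apply: xget_subset1 => //; exact: is_subset1_supremums.
Qed.

Lemma pd_classP (R : pzRingType) (S : lmodType R -> Prop) :
  (forall M, S M -> (pd M < +oo)%E) ->
  [\/ (forall M, ~ S M) /\ pd_class S = (-1)%:E,
      pd_class S = +oo%E
    | exists m, pd_class S = (m%:Z)%:E /\
        forall M, S M -> exists2 n, (n <= m)%N & has_proj_resolution M n].
Proof.
move=> Sfin; have [[M0 SM0]|S0] := pselect (exists M, S M); last first.
  apply: Or31; split=> [M SM|]; first by apply: S0; exists M.
  rewrite /pd_class (_ : (fun v => _) = set0) ?supremum0 //.
  by apply/seteqP; split=> // v [M [SM _]]; apply: S0; exists M.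
have pdE M : S M -> exists n, has_proj_resolution M n /\ pd M = (n%:Z)%:E.
  move=> /Sfin; case: (nat_infP (has_proj_resolution M)) => [[_ E]|[n [Hn E _]]
    _].
    by rewrite /pd E.
  by exists n.
pose V n := exists M, S M /\ pd M = (n%:Z)%:E.
have [n0 [_ pdM0]] := pdE _ SM0.
have [[b Vb]|Vb] := pselect (exists b, forall n, V n -> (n <= b)%N).
  have exV : exists n, `[<V n>] by exists n0; apply/asboolP; exists M0.
  case: (ex_maxnP exV (fun n Vn => Vb n (asboolW Vn))) => m /asboolP[M1 [SM1
    E1]] mmax.
  apply: Or33; exists m; split.
    apply: supremum_eq; first by exists (pd M0); exists M0.
    split=> [_ [M [SM <-]]|w wub]; last by rewrite -E1; apply: wub; exists M1.
    have [n [_ E]] := pdE M SM; rewrite E lee_fin lez_nat.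
    by apply: mmax; apply/asboolP; exists M.
  move=> M SM; have [n [Hn E]] := pdE M SM; exists n => //.
  by apply: mmax; apply/asboolP; exists M.
apply: Or32; apply: supremum_eq; first by exists (pd M0); exists M0.
split=> [v _|w wub]; first exact: leey.
have big b : exists2 n, (b < n)%N & V n.
  apply: contrapT => H; apply: Vb; exists b => n Vn.
  by rewrite leqNgt; apply/negP => bn; apply: H; exists n.
case: w wub => [r|//|] wub.
- have [n rn [M SM]] := big `|r|%N.
  have := wub _ (ex_intro _ M SM); rewrite lee_fin => nr; exfalso.
  have : (n%:Z <= `|r|%N%:Z)%R by apply: le_trans nr _; rewrite abszE ler_norm.
  by rewrite lez_nat leqNgt rn.
have [n _ [M SM]] := big 0%N.
by have := wub _ (ex_intro _ M SM).
Qed.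

Theorem theorem3p19 (k : comNzRingType) (A : algType k)
    (artinA : artin_algebra A) (S : lmodType A^c -> Prop)
    (simple_fin : forall M : lmodType A^c,
       S M -> simple_module M /\ (pd M < +oo)%E) :
  (ext_dim A^c <= pd_class S + layer_length S (A^c)^o)%E.
Proof.
have [RF [B bound]] := artin_algebra_bounds artinA.
have key p n : (forall N, S N -> pd_lt p N) -> layers_le S n (A^c)^o ->
    (0 < p + n)%N -> (ext_dim A^c <= ((p + n).-1%:Z)%:E)%E.
  move=> Sp Ln pn.
  have [m [V [Vs VP]]] := simple_list RF.
  have [K0 K0f K0P] := uniform_bound_module (@finite_length_zero _) (@finite_length_prod _)
    (fun i => nth_syzygy_ex RF p (simple_finite_length (Vs i))).
  have HK T : simple_module T -> exists2 K, nth_syzygy p T K & add_of K0 K.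
    move=> /VP[i iT]; have [K VK KK] := K0P i.
    have [K' TK' K'K] := nth_syzygy_iso iT VK; exists K' => //.
    apply: add_of_retract (add_of_refl _).
    by apply: retract_trans KK; apply/retract_iso/iso_sym.
  have [T Tf TP] := built_from_syzygy RF bound p n K0f.
  suff H : exists T : lmodType A^c,
      fgen T /\ forall M, fgen M <-> tower T (p + n).-1.+1 M.
    rewrite /ext_dim; set D := (X in nat_inf X).
    have [[/(_ (p + n).-1)//]|[d [_ -> dmin]]] := nat_infP D.
    by rewrite lee_fin lez_nat dmin.
  exists T; split=> [|M]; first exact: finite_length_fgen.
  split=> [/(fgen_finite_length RF) Mf|]; last by case: ((p + n).-1) => [[]|? []].
  apply: built_tower => //; rewrite prednK //.
  have [K MK Kb] := nth_syzygy_built RF Sp HK Mf (layers_le_all RF Ln Mf).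
  exact: TP MK Kb.
have SV M : S M -> (pd M < +oo)%E by move=> /simple_fin[].
have [[_ E]|[n [Ln E _]]] := nat_infP (fun i => layers_le S i (A^c)^o).
  rewrite /layer_length E.
  by case: (pd_classP SV) => [[_ ->]|->|[m [-> _]]]; rewrite leey.
rewrite /layer_length E.
case: (pd_classP SV) => [[S0 ->]|->|[m [-> Sm]]].
- case: n Ln E => [|n] Ln _; last first.
    apply: le_trans (key 0%N n.+1 _ Ln _) _ => //; first by move=> N /S0.
    by rewrite -EFinD lee_fin add0n -[n.+1]add1n PoszD addKr.
  (* n = 0 is impossible: no simple is in S, so a simple quotient of R detects
     torsion in R. *)
  exfalso; have [|V [g [Vs gS]]] := @simple_quo _ (A^c)^o RF.
    by move=> R0; have /eqP := R0 (1 : A^c); rewrite oner_eq0.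
  have [[v v0] _] := iffLR (simpleP _) Vs.
  have [||y yt gy] := torsion_detect (S := S) (u := g) RF.
  - by split=> // -[N [/S0]].
  - by have [x xE] := gS v; exists x; rewrite xE.
  by case: gy; rewrite (iffLR (layers_le0 _ _) Ln y yt) linear0.
- by rewrite leey.
have Sp N : S N -> pd_lt m.+1 N.
  move=> /Sm[i im /(resolution_pd_lt RF)[Z Z0 NZ]].
  by exists Z => //; apply: nth_syzygy_pad NZ.
apply: le_trans (key m.+1 n Sp Ln isT) _.
by rewrite -EFinD lee_fin addSn PoszD.
Qed.
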